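(* Let $\kappa>0$ and let $\overline{W}_n^{\rm G}(x_1,\dots,x_n;N,\kappa)$ denote the $n$-point cumulant generating function (as a formal series in $1/x_1,\dots,1/x_n$) of the Gaussian $\beta$-ensemble with weight $e^{-\kappa x^2}$, $\beta=2\kappa$, extended to continuous values of $N$ through its expansion coefficients. Then for every $n\ge 1$, $$\overline{W}_n^{\rm G}(x_1,\dots,x_n;N,\kappa)=\Big(\frac{-i}{\sqrt{\kappa}}\Big)^n\,\overline{W}_n^{\rm G}\big(i\sqrt{\kappa}\,x_1,\dots,i\sqrt{\kappa}\,x_n;-\kappa N,\kappa^{-1}\big).$$
   Context: For a positive integer $N$ and $\kappa=\beta/2>0$, the Gaussian $\beta$-ensemble is the probability density on $\mathbb R^N$ proportional to $$\prod_{l=1}^N e^{-\kappa\lambda_l^2}\prod_{1\le j<k\le N}|\lambda_k-\lambda_j|^{2\kappa},$$ and $\langle\cdot\rangle$ denotes expectation. For nonnegative integers $p_1,\dots,p_n$ let $\mu^{\rm G}_{p_1,\dots,p_n}(N,\kappa)$ be the mixed (joint) cumulant of the random variables $\sum_{j}\lambda_j^{p_1},\dots,\sum_j\lambda_j^{p_n}$; for $n=1$ this is the moment $m_p^{\rm G}(N,\kappa)=\langle\sum_j\lambda_j^p\rangle$. Define the formal series $$\overline{W}_n^{\rm G}(x_1,\dots,x_n;N,\kappa)=\frac{1}{x_1\cdots x_n}\sum_{p_1,\dots,p_n=0}^\infty\frac{\mu^{\rm G}_{p_1,\dots,p_n}(N,\kappa)}{x_1^{p_1}\cdots x_n^{p_n}}.$$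 Equivalently, with $A_i=\sum_{j=1}^N 1/(x_i-\lambda_j)$, it is the large-$x$ expansion of $\langle A_1\rangle$ for $n=1$, and of $\langle\prod_{l=1}^n(A_l-\langle A_l\rangle)\rangle$ for $n=2,3$ (for $n\ge4$, of the joint cumulant of $A_1,\dots,A_n$). For fixed $\kappa$ each $\mu^{\rm G}_{p_1,\dots,p_n}(N,\kappa)$ is a polynomial in $N$, and this polynomial is used to give meaning to $\overline{W}_n^{\rm G}$ for values of $N$ that are not positive integers, in particular for $N$ replaced by $-\kappa N$. The identity is an identity of formal series (i.e. coefficient by coefficient). *)

(* Defs.v *)
From HB Require Import structures.
From mathcomp Require Import all_boot all_order all_algebra.
From mathcomp Require Import all_classical all_reals all_analysis.
From mathcomp Require Import complex.

Set Implicit Arguments.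
Unset Strict Implicit.
Unset Printing Implicit Defensive.

Import Order.TTheory GRing.Theory Num.Theory.
Import numFieldNormedType.Exports.

Local Open Scope ring_scope.

(* Joint cumulant of X_0, ..., X_(n-1) for an expectation functional E:
   the sum over set partitions pi of the index set of
   (-1)^(#pi - 1) (#pi - 1)! prod_(B in pi) E (prod_(i in B) X_i). *)
Definition joint_cumulant (R : realType) (T : Type) (E : (T -> R) -> R)
    (n : nat) (X : 'I_n -> T -> R) : R :=
  \sum_(pi : {set {set 'I_n}} | finset.partition pi (finset.setTfor 'I_n))
    (-1) ^+ #|pi|.-1 * (#|pi|.-1)`!%:R *
    \prod_(B in pi) E (fun t => \prod_(i in B) X i t).

(* The library has a sigma-algebra on tuples but no n-fold product measure:
   Lebesgue measure on R^(N+1) is the image of its product with the one on R^N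
   under (x, t) |-> x :: t. *)
Section lebesgue_tuple.
Context (R : realType).

Local Notation mR := (measurableTypeR R).

Definition tcons N (xt : mR * N.-tuple mR) : N.+1.-tuple mR :=
  [the N.+1.-tuple mR of xt.1 :: xt.2].

Lemma measurable_tcons N : measurable_fun setT (@tcons N).
Proof. exact: measurable_cons. Qed.

Section step.
Local Open Scope classical_set_scope.
Local Open Scope ereal_scope.
Context (N : nat) (m : {sigma_finite_measure set (N.-tuple mR) -> \bar R}).

Definition lebesgue_tcons : set (N.+1.-tuple mR) -> \bar R :=
  pushforward (lebesgue_measure \x m) (@tcons N).

Let prodm : {measure set (mR * N.-tuple mR) -> \bar R} :=
  (@lebesgue_measure R \x m).

Let measurable_preim A : measurable A -> measurable (@tcons N @^-1` A).
Proof. by move=> mA; rewrite -[X in measurable X]setTI; exact: measurable_tcons. Qed.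

Let tcons0 : lebesgue_tcons set0 = 0.
Proof. by rewrite /lebesgue_tcons /pushforward preimage_set0 (measure0 prodm). Qed.

Let tcons_ge0 A : 0 <= lebesgue_tcons A.
Proof. exact: (measure_ge0 prodm). Qed.

Let tcons_additive : semi_sigma_additive lebesgue_tcons.
Proof.
move=> F mF tF mUF; rewrite /lebesgue_tcons /pushforward preimage_bigcup.
apply: (measure_semi_sigma_additive (s := prodm)).
- by move=> i; exact: measurable_preim.
- apply/trivIsetP => /= i j _ _ ij; rewrite -preimage_setI.
  by move/trivIsetP : tF => /(_ _ _ _ _ ij) ->//; rewrite preimage_set0.
- by rewrite -preimage_bigcup; exact: measurable_preim.
Qed.

HB.instance Definition _ := isMeasure.Build _ _ _ lebesgue_tcons
  tcons0 tcons_ge0 tcons_additive.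

Let tcons_sigma_finite : sigma_finite setT lebesgue_tcons.
Proof.
have /sigma_finiteP[/= A [AT ndA mA]] := sigma_finiteT (@lebesgue_measure R).
have /sigma_finiteP[/= B [BT ndB mB]] := sigma_finiteT m.
pose tl (t : N.+1.-tuple mR) : N.-tuple mR := [tuple of behead t].
pose F k := (fun t : N.+1.-tuple mR => tnth t ord0) @^-1` A k `&` tl @^-1` B k.
have tlK x t : tl (tcons (x, t)) = t by exact/val_inj.
have preF k : @tcons N @^-1` F k = A k `*` B k.
  by apply/seteqP; split => -[x t] [/= Ax Bt]; split; rewrite //= ?tlK in Bt *.
exists F => [|k].
  apply/seteqP; split => // t _.
  have [i _ Ai] : (\bigcup_i A i) (tnth t ord0) by rewrite -AT.
  have [j _ Bj] : (\bigcup_i B i) (tl t) by rewrite -BT.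
  exists (maxn i j) => //; split.
    by have /subsetPset := ndA _ _ (leq_maxl i j); apply.
  by have /subsetPset := ndB _ _ (leq_maxr i j); apply.
have [mAk Ak] := mA k; have [mBk Bk] := mB k; split.
  apply: measurableI; rewrite -[X in measurable X]setTI.
    exact: (measurable_tnth ord0).
  exact: measurable_behead.
rewrite /lebesgue_tcons /pushforward preF product_measure1E//.
by rewrite lte_mul_pinfty// ge0_fin_numE.
Qed.

HB.instance Definition _ :=
  @Measure_isSigmaFinite.Build _ _ _ lebesgue_tcons tcons_sigma_finite.

End step.

Fixpoint lebesgue_tuple (N : nat) :
    {sigma_finite_measure set (N.-tuple mR) -> \bar R} :=
  match N with
  | 0 => \d_ ([tuple] : 0.-tuple mR)
  | N'.+1 => lebesgue_tcons (lebesgue_tuple N')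
  end.

End lebesgue_tuple.

Section gaussian_beta_ensemble.
Context (R : realType).

(* Unnormalised density exp(- kappa sum l_j^2) prod_(j < k) |l_k - l_j|^(2 kappa). *)
Definition gbe_weight (N : nat) (kappa : R)
    (l : N.-tuple (measurableTypeR R)) : R :=
  (\prod_(j < N) expR (- kappa * tnth l j ^+ 2)) *
  \prod_(j < N) \prod_(k < N | (j < k)%N)
    `|tnth l k - tnth l j| `^ (2 * kappa).

Definition gbe_mean (N : nat) (kappa : R)
    (f : N.-tuple (measurableTypeR R) -> R) : R :=
  (\int[lebesgue_tuple R N]_l (f l * gbe_weight kappa l)) /
  (\int[lebesgue_tuple R N]_l gbe_weight kappa l).

Definition power_sum (N p : nat) (l : N.-tuple (measurableTypeR R)) : R :=
  \sum_(j < N) tnth l j ^+ p.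

(* Mixed cumulant mu_(p_0, ..., p_(n-1))(N, kappa), for N a natural number. *)
Definition muG (N : nat) (kappa : R) (n : nat) (p : 'I_n -> nat) : R :=
  joint_cumulant (@gbe_mean N kappa) (fun i => @power_sum N (p i)).

(* P extends N |-> muG N kappa p; at most one polynomial does. *)
Definition extends_muG (kappa : R) (n : nat) (p : 'I_n -> nat)
    (P : {poly R}) : Prop :=
  forall N : nat, (0 < N)%N -> P.[N%:R] = muG N kappa p.

Definition muG_poly (kappa : R) (n : nat) (p : 'I_n -> nat) : {poly R} :=
  xget 0 (extends_muG kappa p).

Local Notation C := (complex R).

Definition muG_ext (N : C) (kappa : R) (n : nat) (p : 'I_n -> nat) : C :=
  (map_poly (real_complex R) (muG_poly kappa p)).[N].

End gaussian_beta_ensemble.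

(* A formal series in 1/x_0, ..., 1/x_(n-1), given by its coefficients:
   F e is the coefficient of prod_i x_i^(- e i). *)
Definition inv_series (K : Type) (n : nat) := ('I_n -> nat) -> K.

Section inv_series.
Context (K : fieldType) (n : nat).

(* a F(x_0, ..., x_(n-1)) *)
Definition series_scale (a : K) (F : inv_series K n) : inv_series K n :=
  fun e => a * F e.

(* F(c x_0, ..., c x_(n-1)) *)
Definition series_dilate (c : K) (F : inv_series K n) : inv_series K n :=
  fun e => (\prod_(i < n) c ^- e i) * F e.

End inv_series.

(* The prefactor 1/(x_0 ... x_(n-1)) shifts the exponents by one: mu_p is the
   coefficient of prod_i x_i^(- (p i + 1)), and a series exponent 0 does not
   occur. *)
Definition WG (R : realType) (n : nat) (N : complex R) (kappa : R) :
    inv_series (complex R) n :=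
  fun e => if [forall i, (0 < e i)%N]
           then muG_ext N kappa (fun i => (e i).-1) else 0.

Arguments WG {R} n N kappa _.

(* Main.v *)
Require Import Defs.
From mathcomp Require Import all_boot all_order all_algebra.
From mathcomp Require Import all_classical all_reals all_analysis.
From mathcomp Require Import complex.
From mathcomp Require Import measurable_realfun.
From mathcomp Require Import ring lra zify.

(* Write p_q for the q-th power sum.  Integrating the divergence of the vector
   field (l_1^r F, ..., l_N^r F) against the weight gives the loop equations
     2k <p_(r+1) F> = (1-k) r <p_(r-1) F> + k sum_(a+b=r-1) <p_a p_b F>
                      + sum_j q_j <p_(r+q_j-1) F/p_(q_j)>
   for F = p_(q_1) ... p_(q_m).  With p_0 = N they determine all the mixed
   moments recursively, as polynomials in N.  The substitution
   (k, N, p_q) |-> (1/k, -kN, - k^-1 (i sqrt k)^(-q) p_q) preserves the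
   equations, hence the moments; cumulants are multilinear in the p_q.

   When k < 1/2 the weight is not differentiable where two variables collide,
   so |x|^(2k) is first replaced by (x^2+e)^k; since l_k^r - l_j^r is divisible
   by l_k - l_j, every term of the regularised equation converges dominatedly
   as e -> 0. *)

Set Implicit Arguments.
Unset Strict Implicit.
Unset Printing Implicit Defensive.

Import Order.TTheory GRing.Theory Num.Theory.
Import numFieldNormedType.Exports.

Local Open Scope classical_set_scope.
Local Open Scope ring_scope.

(** * The loop recursion and its duality *)

Definition del (j : nat) (q : seq nat) : seq nat := take j q ++ drop j.+1 q.

(* The mixed moment of the power sums with exponents q, by the loop equations.
   The parameter h stands for 1/(2k), so that the recursion also makes sense over
   polynomials, with N the indeterminate.  Wherever a predecessor is truncated
   its coefficient vanishes.  Fuel sumn q + size q suffices. *)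
Fixpoint loop_mom (K : comNzRingType) (h k N : K) (fuel : nat) (q : seq nat) : K :=
  match fuel, q with
  | _, [::] => 1
  | 0%N, _ => 0
  | m.+1, 0%N :: F => N * loop_mom h k N m F
  | m.+1, r.+1 :: F =>
    h * ((1 - k) * r%:R * loop_mom h k N m (r.-1 :: F)
         + k * (\sum_(a < r) loop_mom h k N m [:: (a : nat), (r.-1 - a)%N & F])
         + \sum_(j < size F) (nth 0%N F j)%:R *
             loop_mom h k N m ((r + nth 0%N F j).-1 :: del j F))
  end.

(** The recursion uses ring operations only. Applied to evaluation of polynomials and to the
    embedding of the reals in the complex numbers, this yields polynomiality in N and the value at
    complex N. *)
Lemma rmorph_loop_mom (K L : comNzRingType) (f : {rmorphism K -> L})
    (h k N : K) m q :
  f (loop_mom h k N m q) = loop_mom (f h) (f k) (f N) m q.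
Proof.
elim: m q => [|m IH] [|[|r] F] /=; rewrite ?rmorph0 ?rmorph1 //.
  by rewrite rmorphM IH.
rewrite !(rmorphM, rmorphD, rmorph_sum, rmorphN, rmorph_nat, rmorph1) /= IH.
congr (_ * (_ + _ * _ + _)).
  by apply: eq_bigr => a _; rewrite IH.
by apply: eq_bigr => j _; rewrite rmorphM rmorph_nat IH.
Qed.

Lemma size_del j q : (j < size q)%N -> size q = (size (del j q)).+1.
Proof.
by move=> jq; rewrite size_cat size_takel ?size_drop 1?ltnW// -addnS subnSK// subnKC// ltnW.
Qed.

Lemma perm_del j q : (j < size q)%N -> perm_eq q (nth 0%N q j :: del j q).
Proof.
move=> jq; rewrite -[X in perm_eq X _](cat_take_drop j) (drop_nth 0%N)//.
by rewrite perm_catC/= perm_cons perm_catC.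
Qed.

Lemma sumn_del j q : (j < size q)%N -> sumn q = (nth 0 q j + sumn (del j q))%N.
Proof. by move=> /perm_del /perm_sumn. Qed.

(** Induction on the fuel: each exponent i carries the weight - k^-1 s^i, where s plays the part of
    (i sqrt k)^-1, and the three groups of terms of the recursion rescale compatibly. *)
Lemma loop_mom_dual (K : fieldType) (k s N : K) m q :
    k != 0 -> s ^+ 2 = - k^-1 -> (2 : K) != 0 ->
  \prod_(i <- q) (- k^-1 * s ^+ i) * loop_mom (2 * k^-1)^-1 k^-1 (- (k * N)) m q =
  loop_mom (2 * k)^-1 k N m q.
Proof.
move=> k0 s2 two0; elim: m q => [|m IH] [|[|r] F] /=; rewrite ?big_nil ?mul1r ?mulr0//.
  rewrite big_cons -IH; move: (\prod_(_ <- _) _) (loop_mom _ _ _ _ _) => x y.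
  by field.
rewrite big_cons.
set P := \prod_(i <- F) _.
pose h' := (2 * k^-1)^-1; pose N' := - (k * N).
(* Relative to s^(r+1) P, the weights of the lists in the three groups are 1, - k^-1 and - k. They
   turn the coefficients 1 - k, k, 1 into 1 - k, -1, - k, which is - k times the coefficients 1 -
   k^-1, k^-1, 1 of the dual recursion. *)
have E1 : r%:R * loop_mom (2 * k)^-1 k N m (r.-1 :: F) =
    r%:R * (s ^+ r.+1 * P * loop_mom h' k^-1 N' m (r.-1 :: F)).
  case: r => [|r]; first by rewrite !mul0r.
  by rewrite -IH big_cons /= -/P -/h' -/N' -[in RHS]addn2 exprD s2; congr (_ * _); ring.
have E2 : \sum_(a < r) loop_mom (2 * k)^-1 k N m [:: (a : nat), (r.-1 - a)%N & F] =
    - k^-1 * (s ^+ r.+1 * P) *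
    \sum_(a < r) loop_mom h' k^-1 N' m [:: (a : nat), (r.-1 - a)%N & F].
  rewrite mulr_sumr; apply: eq_bigr => a _; rewrite -IH !big_cons -/P -/h' -/N'.
  have -> : s ^+ r.+1 = s ^+ a * s ^+ (r.-1 - a) * s ^+ 2.
    by rewrite -!exprD; congr (_ ^+ _); case: (r) a => [[]|r'] //= [a] /=; lia.
  by rewrite s2; ring.
have E3 : \sum_(j < size F) (nth 0%N F j)%:R *
             loop_mom (2 * k)^-1 k N m ((r + nth 0%N F j).-1 :: del j F) =
   - k * (s ^+ r.+1 * P) * \sum_(j < size F) (nth 0%N F j)%:R *
             loop_mom h' k^-1 N' m ((r + nth 0%N F j).-1 :: del j F).
  rewrite mulr_sumr; apply: eq_bigr => j _; rewrite -IH big_cons -/h' -/N'.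
  have -> : P = - k^-1 * s ^+ nth 0%N F j * \prod_(i <- del j F) (- k^-1 * s ^+ i).
    by rewrite /P (perm_big _ (perm_del (ltn_ord j))) big_cons.
  case: (nth 0%N F j) => [|a]; first by rewrite !mul0r !mulr0.
  rewrite addnS /= exprD [s ^+ r.+1]exprS [s ^+ a.+1]exprS.
  move: (loop_mom _ _ _ _ _) (\prod_(_ <- _) _) => x y.
  (* The inserted factor - k s^2 equals 1. *)
  transitivity (- k * s ^+ 2 * (a.+1%:R * (- k^-1 * (s ^+ r * s ^+ a) * y * x))).
    by rewrite s2 mulrNN divff// mul1r.
  by ring.
rewrite -/h' -/N' E2 E3 -[(1 - k) * _ * loop_mom (2 * k)^-1 _ _ _ _]mulrA E1.
rewrite /h'; move: (loop_mom _ _ _ _ _) (\sum_(_ < _) _) (\sum_(_ < _) _) => x y z.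
by rewrite invf_div invfM; field; rewrite two0 k0.
Qed.

(** * Cumulants built from the recursive moments *)

Definition loop_cumulant (K : comNzRingType) (h k N : K) n (p : 'I_n -> nat) : K :=
  \sum_(pi : {set {set 'I_n}} | finset.partition pi (finset.setTfor 'I_n))
    (-1) ^+ #|pi|.-1 * (#|pi|.-1)`!%:R *
    \prod_(B in pi) (let q := [seq p i | i <- enum B] in
                      loop_mom h k N (sumn q + size q) q).

Lemma rmorph_loop_cumulant (K L : comNzRingType) (f : {rmorphism K -> L})
    (h k N : K) n (p : 'I_n -> nat) :
  f (loop_cumulant h k N p) = loop_cumulant (f h) (f k) (f N) p.
Proof.
rewrite rmorph_sum; apply: eq_bigr => pi _ /=.
rewrite !rmorphM rmorph_sign rmorph_nat rmorph_prod; congr (_ * _).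
by apply: eq_bigr => B _; rewrite rmorph_loop_mom.
Qed.

(** The blocks of a partition contain every index exactly once, so the weights of the blocks
    multiply to the same factor for all partitions. *)
Lemma loop_cumulant_dual (K : fieldType) (k s N : K) n (p : 'I_n -> nat) :
    k != 0 -> s ^+ 2 = - k^-1 -> (2 : K) != 0 ->
  \prod_i (- k^-1 * s ^+ p i) * loop_cumulant (2 * k^-1)^-1 k^-1 (- (k * N)) p =
  loop_cumulant (2 * k)^-1 k N p.
Proof.
move=> k0 s2 two0; rewrite mulr_sumr; apply: eq_bigr => pi pipart.
rewrite mulrCA; congr (_ * _).
rewrite (eq_bigl (fun i => i \in finset.setTfor 'I_n)); last by move=> i; rewrite finset.inE.
rewrite (set_partition_big _ pipart) -big_split; apply: eq_bigr => B _ /=.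
by rewrite -(loop_mom_dual N _ _ k0 s2 two0) big_map big_enum.
Qed.

(** * Integration over tuples *)

Section lebesgue_tuple_integral.
Context (R : realType).
Local Notation mR := (measurableTypeR R).
Local Notation mu := (@lebesgue_measure R).
Local Notation muT := (lebesgue_tuple R).
Local Open Scope ereal_scope.

Lemma ge0_integral_lebesgue_tupleS N (f : N.+1.-tuple mR -> \bar R) :
  measurable_fun [set: N.+1.-tuple mR] f -> (forall l, 0 <= f l) ->
  \int[muT N.+1]_l f l = \int[mu]_x \int[muT N]_t f (tcons (x, t)).
Proof.
move=> mf f0.
transitivity (\int[mu \x muT N]_z (f \o @tcons R N) z).
  by rewrite -(ge0_integral_pushforward (@measurable_tcons R N) _ measurableT).
rewrite fubini_tonelli1//=.
  by apply: measurableT_comp => //; exact: measurable_tcons.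
Qed.

Section integrable.
Context N (f : N.+1.-tuple mR -> \bar R).
Hypothesis intf : (muT N.+1).-integrable setT f.

Let intfc : (mu \x muT N).-integrable setT (f \o @tcons R N).
Proof.
apply/integrableP; split.
  apply: measurableT_comp => //; last exact: measurable_tcons.
  exact: measurable_int intf.
have /integrableP[mf] := intf.
rewrite -(ge0_integral_pushforward (@measurable_tcons R N) (mu \x muT N) measurableT (f := abse \o f))//.
  by apply: measurableT_comp.
by move=> y _; exact: abse_ge0.
Qed.

(** This order of integration freezes the head, for an induction on the tail; the reverse order, in
    [integral_lebesgue_tupleS21], integrates over the head first. *)
Lemma integral_lebesgue_tupleS12 :
  \int[muT N.+1]_l f l = \int[mu]_x \int[muT N]_t f (tcons (x, t)).
Proof.
transitivity (\int[mu \x muT N]_z (f \o @tcons R N) z).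
  rewrite -(integral_pushforward (@measurable_tcons R N) _ intfc measurableT)//.
  exact: measurable_int intf.
by rewrite -integral12_prod_meas1.
Qed.

Lemma integral_lebesgue_tupleS21 :
  \int[muT N.+1]_l f l = \int[muT N]_t \int[mu]_x f (tcons (x, t)).
Proof.
transitivity (\int[mu \x muT N]_z (f \o @tcons R N) z).
  rewrite -(integral_pushforward (@measurable_tcons R N) _ intfc measurableT)//.
  exact: measurable_int intf.
by rewrite -integral21_prod_meas1.
Qed.

End integrable.

Lemma tnth_tcons0 N x (t : N.-tuple mR) : tnth (tcons (x, t)) ord0 = x.
Proof. by rewrite (tnth_nth x). Qed.

Lemma tnth_tconsS N x (t : N.-tuple mR) j :
  tnth (tcons (x, t)) (lift ord0 j) = tnth t j.
Proof. by rewrite !(tnth_nth x). Qed.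

Lemma measurable_prod_tnth N (h : 'I_N -> R -> R) :
  (forall i, measurable_fun setT (h i)) ->
  measurable_fun [set: N.-tuple mR] (fun l => \prod_(j < N) h j (tnth l j))%R.
Proof.
move=> mh; apply: measurable_prod => j _.
by apply: (measurableT_comp (mh j)); exact: measurable_tnth.
Qed.

Lemma ge0_integral_prod_tuple N (h : 'I_N -> R -> R) :
    (forall i, measurable_fun setT (h i)) -> (forall i x, (0 <= h i x)%R) ->
  \int[muT N]_l (\prod_(j < N) h j (tnth l j))%:E =
  \prod_(j < N) \int[mu]_x (h j x)%:E.
Proof.
elim: N h => [|N IH] h mh h0.
  rewrite big_ord0 /= integral_dirac//= ?diracT ?mul1e ?big_ord0//.
  by apply/measurable_EFinP; apply: measurable_prod_tnth.
rewrite ge0_integral_lebesgue_tupleS; last 2 first.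
- by apply/measurable_EFinP; apply: measurable_prod_tnth.
- by move=> l; rewrite lee_fin; apply: prodr_ge0 => j _; exact: h0.
under eq_integral => x _.
  under eq_integral => t _.
    rewrite big_ord_recl tnth_tcons0 EFinM.
    under eq_bigr => j _ do rewrite tnth_tconsS.
    over.
  rewrite ge0_integralZl//; last 3 first.
  - apply/measurable_EFinP; apply: (measurable_prod_tnth (h := fun j => h (lift ord0 j))).
    by move=> i; exact: mh.
  - by move=> t _; rewrite lee_fin; apply: prodr_ge0 => j _; exact: h0.
  - by rewrite lee_fin h0.
  rewrite (IH (fun j => h (lift ord0 j)))//.
  over.
rewrite ge0_integralZr//.
- by rewrite big_ord_recl.
- exact: (measurableT_comp (@EFin_measurable _ _) (mh ord0)).
- by move=> x _; rewrite lee_fin h0.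
- by apply: prode_ge0 => j _; apply: integral_ge0 => x _; rewrite lee_fin h0.
Qed.

Lemma integrable_prod_tuple N (h : R -> R) :
    measurable_fun setT h -> (forall x, (0 <= h x)%R) ->
    mu.-integrable setT (EFin \o h) ->
  (muT N).-integrable setT (fun l => (\prod_(j < N) h (tnth l j))%:E).
Proof.
move=> mh h0 ih; have mp := @measurable_prod_tnth N (fun=> h) (fun=> mh).
apply/integrableP; split; first exact/measurable_EFinP.
under eq_integral => l _.
  rewrite gee0_abs; last by rewrite lee_fin; apply: prodr_ge0.
  over.
rewrite (ge0_integral_prod_tuple (h := fun=> h))//.
rewrite ltey_eq; apply/orP; left.
rewrite prode_fin_num// => j _.
exact: integrable_fin_num ih.
Qed.

(** The map x |-> [upd l i x] parametrises the i-th coordinate line through l; partial derivatives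
    and partial integrals are taken along it. *)
Definition upd N (l : N.-tuple mR) (i : 'I_N) (x : R) : N.-tuple mR :=
  [tuple if j == i then x : mR else tnth l j | j < N].

Lemma tnth_upd N (l : N.-tuple mR) i x j :
  tnth (upd l i x) j = if j == i then x else tnth l j.
Proof. by rewrite tnth_mktuple. Qed.

Lemma upd_tcons0 N x (t : N.-tuple mR) y : upd (tcons (x, t)) ord0 y = tcons (y, t).
Proof.
apply: eq_from_tnth => j; rewrite tnth_upd.
by case: (unliftP ord0 j) => [k|] ->; rewrite ?tnth_tcons0// !tnth_tconsS.
Qed.

Lemma upd_tconsS N x (t : N.-tuple mR) k y :
  upd (tcons (x, t)) (lift ord0 k) y = tcons (x, upd t k y).
Proof.
apply: eq_from_tnth => j; rewrite tnth_upd.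
case: (unliftP ord0 j) => [m|] ->; rewrite ?tnth_tcons0// !tnth_tconsS tnth_upd.
by rewrite (inj_eq lift_inj).
Qed.

(** The product bound makes G integrable, so Fubini allows the i-th variable to be integrated first.
    The bound passes to slices: the factor h x of a frozen head is absorbed in the constant, which
    is therefore generalised in the induction. *)
Lemma integral_upd0 N (G : N.-tuple mR -> R) (i : 'I_N) (C : R) (h : R -> R) :
    measurable_fun setT h -> (forall x, (0 <= h x)%R) ->
    mu.-integrable setT (EFin \o h) ->
    measurable_fun setT G ->
    (forall l, `|G l| <= C * \prod_(j < N) h (tnth l j))%R ->
    (forall l, \int[mu]_x (G (upd l i x))%:E = 0) ->
  \int[muT N]_l (G l)%:E = 0.
Proof.
move=> mh h0 ih; elim: N G i C => [|N IH] G i C mG leG G0; first by case: (i) => -[].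
have iG : (muT N.+1).-integrable setT (EFin \o G).
  apply: (@le_integrable _ _ _ (muT N.+1) setT measurableT (EFin \o G) (fun l => (C * \prod_(j < N.+1) h (tnth l j))%R%:E)).
  - exact/measurable_EFinP.
  - by move=> l _ /=; rewrite lee_fin; exact: le_trans (leG l) (ler_norm _).
  - under eq_fun do rewrite EFinM.
    by apply: integrableZl => //; exact: integrable_prod_tuple.
case: (unliftP ord0 i) G0 => [k|] -> G0.
  rewrite (integral_lebesgue_tupleS12 iG).
  apply: integral0_eq => x _ /=.
  apply: (IH (fun t => G (tcons (x, t))) k (C * h x)%R).
  - apply: (measurableT_comp mG).
    apply: (measurableT_comp (@measurable_tcons R N)).
    exact: pair1_measurable.
  - move=> t; apply: le_trans (leG _) _.
    rewrite big_ord_recl tnth_tcons0 mulrA.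
    by under eq_bigr do rewrite tnth_tconsS.
  - by move=> t; have := G0 (tcons (x, t)); under eq_integral do rewrite upd_tconsS.
rewrite (integral_lebesgue_tupleS21 iG).
apply: integral0_eq => t _ /=.
(* The head 0 is arbitrary, as [upd] overwrites it. *)
by have := G0 (tcons (0%R, t)); under eq_integral do rewrite upd_tcons0.
Qed.
End lebesgue_tuple_integral.

(** * Gaussian tails *)

Section gaussian_tail.
Context (R : realType).
Local Notation mu := (@lebesgue_measure R).
Implicit Types a x : R.

Definition gauss a x := expR (- a * x ^+ 2).

Lemma gauss_ge0 a x : 0 <= gauss a x.
Proof. exact: expR_ge0. Qed.

Lemma measurable_gauss a : measurable_fun setT (gauss a).
Proof.
by apply: measurableT_comp => //; apply: measurable_funM => //; exact: measurable_funX.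
Qed.

Lemma integrable_gauss a : 0 < a -> mu.-integrable setT (EFin \o gauss a).
Proof.
(* The standard deviation for which x^2 / (2 s^2) = a x^2. *)
move=> a0; pose s := (Num.sqrt (2 * a))^-1.
have s0 : s != 0 by rewrite invr_neq0// gt_eqF// sqrtr_gt0 mulr_gt0.
have -> : EFin \o gauss a = EFin \o normal_fun 0 s.
  apply/funext => x /=; congr (expR _)%:E.
  rewrite subr0 exprVn sqr_sqrtr ?mulr_ge0 ?ltW//.
  by field; rewrite gt_eqF.
have -> : normal_fun 0 s = fun x => (normal_peak s)^-1 * normal_pdf 0 s x.
  apply/funext => x; rewrite /normal_pdf (negbTE s0) mulKf//.
  by rewrite gt_eqF// normal_peak_gt0.
rewrite /comp; under eq_fun do rewrite EFinM.
by apply: integrableZl => //; exact: integrable_normal_pdf.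
Qed.

(** Since n <= (n+1)^2, the values lie below the geometric sequence exp(-a)^n. This disposes of the
    boundary terms in the integration by parts. *)
Lemma cvg_gauss_nat a C : 0 < a -> (C * gauss a n.+1%:R) @[n --> \oo] --> (0 : R).
Proof.
move=> a0; rewrite -(mulr0 C); apply: cvgMr.
apply: (@squeeze_cvgr _ _ _ _ (fun=> 0) (fun n : nat => expR (- a) ^+ n)).
- apply: nearW => n; rewrite gauss_ge0 /gauss /= -expRM_natl ler_expR.
  rewrite mulNr mulrN lerN2 mulrC ler_pM2l// -natrX ler_nat.
  by rewrite (leq_trans (leqnSn n))// leq_pmulr.
- exact: cvg_cst.
- apply: cvg_expr; rewrite ger0_norm ?expR_ge0//.
  by rewrite -expR0 ltr_expR oppr_lt0.
Qed.

(** On [-(n+1), n+1] the fundamental theorem of calculus gives g(n+1) - g(-(n+1)), which tends to 0;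
    dominated convergence identifies the limit of these integrals with the integral over the
    line. *)
Lemma integral_derive_gauss_bound (g g' : R -> R) a C :
    0 < a -> (forall x, is_derive x 1 g (g' x)) -> continuous g' ->
    (forall x, `|g x| <= C * gauss a x) -> (forall x, `|g' x| <= C * gauss a x) ->
  (\int[mu]_x (g' x)%:E = 0)%E.
Proof.
move=> a0 dg cg' leg leg'.
pose A n := `[- n.+1%:R, n.+1%:R : R]%classic.
have mg' : measurable_fun setT g' by exact: continuous_measurable_fun.
have ig : mu.-integrable setT (fun x => (C * gauss a x)%:E).
  by under eq_fun do rewrite EFinM; apply: integrableZl => //; exact: integrable_gauss.
have fA n x : `|(g' \_ (A n)) x| <= C * gauss a x.
  rewrite patchE; case: ifPn => _ //.
  by rewrite normr0; exact: le_trans (leg' x).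
have [||||_ _] := @dominated_convergence _ _ _ mu setT measurableT
   (fun n => EFin \o (g' \_ (A n))) (EFin \o g')
   (fun x => (C * gauss a x)%:E) _ _ _ ig _.
- move=> n; apply/measurable_EFinP.
  apply/(measurable_restrictT _ _).1; first exact: measurable_itv.
  exact: measurable_funTS mg'.
- exact/measurable_EFinP.
- apply: aeW => x _; apply: cvg_near_cst.
  near=> n; rewrite /= patchE ifT// inE /A /= in_itv/= -ler_norml.
  rewrite (@le_trans _ _ n%:R) ?ler_nat//.
  by near: n; exact: nbhs_infty_ger.
- by apply: aeW => x n _ /=; rewrite lee_fin.
rewrite (_ : [sequence _]_n = fun n => (g n.+1%:R - g (- n.+1%:R))%:E); last first.
  apply/funext => n /=; rewrite -[X in integral _ _ X]/(EFin \o (g' \_ (A n))) -restrict_EFin.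
  rewrite -integral_mkcond EFinB.
  have cg : continuous g.
    by move=> x; apply/differentiable_continuous/derivable1_diffP; case: (dg x).
  apply: continuous_FTC2.
  - by rewrite (@lt_le_trans _ _ 0)// oppr_lt0 ltr0Sn.
  - exact: continuous_subspaceT.
  - split; first by move=> x _; case: (dg x).
    + exact: cvg_at_right_filter (cg _).
    + exact: cvg_at_left_filter (cg _).
  - by move=> x _; rewrite derive1E; case: (dg x).
move=> /cvg_lim <-//; apply: cvg_lim => //.
apply: cvg_EFin; first by apply: nearW.
rewrite -[X in _ --> X](subr0 (0:R)).
apply: (@cvgB _ R^o).
- apply/norm_cvg0P; apply: (squeeze_cvgr _ (cvg_cst 0) (cvg_gauss_nat C a0)).
  by apply: nearW => n; rewrite normr_ge0 leg.
- apply/norm_cvg0P; apply: (squeeze_cvgr _ (cvg_cst 0) (cvg_gauss_nat C a0)).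
  by apply: nearW => n; rewrite normr_ge0 (le_trans (leg _))// /gauss sqrrN.
Unshelve. all: by end_near. Qed.
End gaussian_tail.

(** * Tempered functions against a Gaussian *)

Section tempered_functions.
Context (R : realType) (N : nat).
Local Notation mR := (measurableTypeR R).
Local Notation T := (N.-tuple mR).
Implicit Types (f g : T -> R) (l : T).

(** A product over the coordinates, so that bounds against the Gaussian, also a product, reduce to
    one variable. *)
Definition bracket l : R := \prod_(j < N) (1 + tnth l j ^+ 2).

Lemma bracket_ge1 l : 1 <= bracket l.
Proof.
rewrite /bracket.
by elim/big_ind : _ => [//|x y|j _]; [exact: mulr_ege1|rewrite lerDl sqr_ge0].
Qed.

Lemma le_bracket l j : 1 + tnth l j ^+ 2 <= bracket l.
Proof.
rewrite /bracket (bigD1 j)//= ler_peMr//.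
  by rewrite addr_ge0// sqr_ge0.
by elim/big_ind : _ => [//|x y|i _]; [exact: mulr_ege1|rewrite lerDl sqr_ge0].
Qed.

Lemma le_bracketB l j k : 1 + (tnth l k - tnth l j) ^+ 2 <= 2 * bracket l ^+ 2.
Proof.
apply: (@le_trans _ _ (2 * ((1 + tnth l k ^+ 2) * (1 + tnth l j ^+ 2)))).
  (* With x = l_k and y = l_j: (x + y)^2 >= 0 gives (x - y)^2 <= 2 x^2 + 2 y^2. *)
  have := sqr_ge0 (tnth l k + tnth l j).
  by have := sqr_ge0 (tnth l k * tnth l j); nra.
rewrite ler_pM2l// expr2; apply: ler_pM; rewrite ?le_bracket//.
  by rewrite addr_ge0// sqr_ge0.
by rewrite addr_ge0// sqr_ge0.
Qed.

(** Polynomial growth: the class is closed under sums and products and its members are integrable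
    against any Gaussian, so it takes care of all integrability conditions below. *)
Definition tempered f := measurable_fun [set: T] f /\
  exists C m, 0 <= C /\ forall l, `|f l| <= C * bracket l ^+ m.

Lemma tempered_cst c : tempered (fun=> c).
Proof.
split; first exact: measurable_cst.
by exists `|c|, 0%N; split=> // l; rewrite expr0 mulr1.
Qed.

Lemma temperedD f g : tempered f -> tempered g -> tempered (fun l => f l + g l).
Proof.
move=> [mf [C [m [C0 lef]]]] [mg [D [n [D0 leg]]]].
split; first exact: measurable_funD.
exists (C + D), (maxn m n); split=> [|l]; first exact: addr_ge0.
rewrite (le_trans (ler_normD _ _))// mulrDl lerD//.
  by rewrite (le_trans (lef l))// ler_wpM2l// ler_weXn2l ?leq_maxl// bracket_ge1.
by rewrite (le_trans (leg l))// ler_wpM2l// ler_weXn2l ?leq_maxr// bracket_ge1.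
Qed.

Lemma temperedM f g : tempered f -> tempered g -> tempered (fun l => f l * g l).
Proof.
move=> [mf [C [m [C0 lef]]]] [mg [D [n [D0 leg]]]].
split; first exact: measurable_funM.
exists (C * D), (m + n)%N; split=> [|l]; first exact: mulr_ge0.
by rewrite normrM exprD mulrACA ler_pM.
Qed.

Lemma temperedN f : tempered f -> tempered (fun l => - f l).
Proof.
move=> /(temperedM (tempered_cst (- 1))).
by under eq_fun do rewrite mulN1r.
Qed.

Lemma tempered_norm f : tempered f -> tempered (fun l => `|f l|).
Proof.
move=> [mf [C [m [C0 lef]]]]; split; first exact: measurableT_comp.
by exists C, m; split=> // l; rewrite normr_id.
Qed.

Lemma tempered_sum I (s : seq I) (P : pred I) (F : I -> T -> R) :
  (forall i, P i -> tempered (F i)) -> tempered (fun l => \sum_(i <- s | P i) F i l).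
Proof.
move=> tF; elim: s => [|i s IH].
  by under eq_fun do rewrite big_nil; exact: tempered_cst.
under eq_fun do rewrite big_cons.
case: (boolP (P i)) => // Pi.
by apply: temperedD => //; exact: tF.
Qed.

Lemma tempered_prod I (s : seq I) (P : pred I) (F : I -> T -> R) :
  (forall i, P i -> tempered (F i)) -> tempered (fun l => \prod_(i <- s | P i) F i l).
Proof.
move=> tF; elim: s => [|i s IH].
  by under eq_fun do rewrite big_nil; exact: tempered_cst.
under eq_fun do rewrite big_cons.
case: (boolP (P i)) => // Pi.
by apply: temperedM => //; exact: tF.
Qed.

Lemma tempered_tnthX j p : tempered (fun l => tnth l j ^+ p).
Proof.
split; first by apply: measurable_funX; exact: measurable_tnth.
exists 1, p; split=> // l; rewrite mul1r normrX lerXn2r ?nnegrE//.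
  exact: le_trans ler01 (bracket_ge1 l).
apply: le_trans (le_bracket l j).
by rewrite -(real_normK (num_real (tnth l j))); have := sqr_ge0 (`|tnth l j| - 1); nra.
Qed.

Lemma tempered_sub_comp (phi : R -> R) C m j k :
    measurable_fun setT phi -> 0 <= C ->
    (forall y, `|phi y| <= C * (1 + y ^+ 2) ^+ m) ->
  tempered (fun l => phi (tnth l k - tnth l j)).
Proof.
move=> mphi C0 lephi; split.
  apply: measurableT_comp => //.
  by apply: measurable_funB; exact: measurable_tnth.
exists (C * 2 ^+ m), (2 * m)%N; split=> [|l]; first by rewrite mulr_ge0// exprn_ge0.
rewrite (le_trans (lephi _))// -mulrA ler_wpM2l// exprM -exprMn.
apply: lerXn2r (le_bracketB _ _ _); rewrite nnegrE.
  by rewrite addr_ge0// sqr_ge0.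
by rewrite mulr_ge0// sqr_ge0.
Qed.

(** * Integration of tempered functions against the Gaussian *)

Definition gaussian (k : R) l : R := \prod_(j < N) gauss k (tnth l j).

Lemma gaussian_gt0 k l : 0 < gaussian k l.
Proof. by apply: prodr_gt0 => j _; exact: expR_gt0. Qed.

Lemma measurable_gaussian k : measurable_fun [set: T] (gaussian k).
Proof. by apply: (measurable_prod_tnth (h := fun=> gauss k)) => _; exact: measurable_gauss. Qed.

Lemma gauss_dominates (k : R) m : 0 < k ->
  exists2 C, 0 <= C & forall x : R, (1 + x ^+ 2) ^+ m * gauss k x <= C * gauss (k / 2) x.
Proof.
(* From 1 + x^2 <= (1 + c^-1) exp(c x^2), the m-th power costs a rate m c, and this c keeps m c <=
   k/2. The successor covers m = 0. *)
move=> k0; pose c := k / (2 * m.+1%:R).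
have c0 : 0 < c by rewrite divr_gt0// mulr_gt0.
exists ((1 + c^-1) ^+ m) => [|x]; first by rewrite exprn_ge0// addr_ge0// invr_ge0 ltW.
apply: (@le_trans _ _ (((1 + c^-1) * expR (c * x ^+ 2)) ^+ m * gauss k x)).
  rewrite ler_wpM2r ?gauss_ge0// lerXn2r ?nnegrE ?addr_ge0 ?sqr_ge0//.
    by rewrite mulr_ge0 ?expR_ge0// addr_ge0// invr_ge0 ltW.
  apply: (@le_trans _ _ ((1 + c^-1) * (1 + c * x ^+ 2))).
    rewrite mulrDl mul1r !mulrDr mulr1 mulKf ?gt_eqF//.
    have := sqr_ge0 x; have : 0 <= c^-1 by rewrite invr_ge0 ltW.
    by move=> ? ?; rewrite -!addrA lerD2l; nra.
  by rewrite ler_wpM2l ?expR_ge1Dx// addr_ge0// invr_ge0 ltW.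
rewrite exprMn -mulrA ler_wpM2l ?exprn_ge0 ?addr_ge0 ?invr_ge0//; first exact: ltW.
rewrite /gauss -expRM_natl -expRD ler_expR.
have mk : m%:R * c <= k / 2.
  rewrite /c mulrA ler_pdivrMr ?mulr_gt0// -[m.+1]addn1 natrD.
  have -> : k / 2 * (2 * (m%:R + 1%:R)) = k * m%:R + k by field.
  by rewrite mulrC lerDl ltW.
have := ler_wpM2r (sqr_ge0 x) mk.
by rewrite !mulNr -mulrA; lra.
Qed.

(** Half of the Gaussian decay absorbs the polynomial growth, one coordinate at a time. *)
Lemma tempered_gaussian_le f (k : R) : 0 < k -> tempered f ->
  exists2 C, 0 <= C & forall l, `|f l * gaussian k l| <= C * gaussian (k / 2) l.
Proof.
move=> k0 [_ [C [m [C0 lef]]]]; have [D D0 leD] := gauss_dominates m k0.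
exists (C * D ^+ N) => [|l]; first by rewrite mulr_ge0// exprn_ge0.
rewrite normrM (gtr0_norm (gaussian_gt0 _ _)).
apply: (@le_trans _ _ (C * bracket l ^+ m * gaussian k l)).
  by rewrite ler_wpM2r// ltW// gaussian_gt0.
rewrite -!mulrA ler_wpM2l// /bracket -prodrXl -big_split/=.
rewrite -[X in D ^+ X]card_ord -prodr_const -big_split/=.
by apply: ler_prod => j _; rewrite leD mulr_ge0 ?gauss_ge0// exprn_ge0// addr_ge0// sqr_ge0.
Qed.

Lemma integrable_tempered f (k : R) : 0 < k -> tempered f ->
  (lebesgue_tuple R N).-integrable setT (fun l => (f l * gaussian k l)%:E).
Proof.
move=> k0 tf; have [C C0 leC] := tempered_gaussian_le k0 tf.
apply: (@le_integrable _ _ _ (lebesgue_tuple R N) setT measurableT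
    (fun l => (f l * gaussian k l)%:E) (fun l => (C * gaussian (k / 2) l)%:E)).
- apply/measurable_EFinP; apply: measurable_funM; last exact: measurable_gaussian.
  by case: tf.
- move=> l _ /=; rewrite lee_fin; exact: le_trans (leC l) (ler_norm _).
- under eq_fun do rewrite EFinM.
  apply: integrableZl => //; apply: integrable_prod_tuple.
  + exact: measurable_gauss.
  + exact: gauss_ge0.
  + by apply: integrable_gauss; rewrite divr_gt0.
Qed.

(** Only the Gaussian belongs to the integral; the Vandermonde factor and its regularisations are
    tempered and enter through f. *)
Definition gint (k : R) f : R := \int[lebesgue_tuple R N]_l (f l * gaussian k l).

Lemma gint_EFin k f : 0 < k -> tempered f ->
  (gint k f)%:E = (\int[lebesgue_tuple R N]_l (f l * gaussian k l)%:E)%E.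
Proof.
by move=> k0 tf; rewrite fineK//; apply: integrable_fin_num => //; exact: integrable_tempered.
Qed.

Lemma gintD k f g : 0 < k -> tempered f -> tempered g ->
  gint k (fun l => f l + g l) = gint k f + gint k g.
Proof.
move=> k0 tf tg; rewrite /gint -RintegralD//; try exact: integrable_tempered.
by apply: eq_Rintegral => l _; rewrite mulrDl.
Qed.

Lemma gintZ k f c : 0 < k -> tempered f ->
  gint k (fun l => c * f l) = c * gint k f.
Proof.
move=> k0 tf; rewrite /gint -RintegralZl//; last exact: integrable_tempered.
by apply: eq_Rintegral => l _; rewrite mulrA.
Qed.

Lemma gint_sum k I (s : seq I) (F : I -> T -> R) : 0 < k ->
  (forall i, tempered (F i)) ->
  gint k (fun l => \sum_(i <- s) F i l) = \sum_(i <- s) gint k (F i).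
Proof.
move=> k0 tF; elim: s => [|i s IH].
  rewrite big_nil /gint /Rintegral integral0_eq// => l _.
  by rewrite big_nil mul0r.
rewrite big_cons -IH -gintD//; last exact: tempered_sum.
by apply: eq_Rintegral => l _; rewrite big_cons.
Qed.

Lemma gint_cvg k (f_ : nat -> T -> R) f g : 0 < k ->
    (forall n, tempered (f_ n)) -> tempered f -> tempered g ->
    (forall l, f_ n l @[n --> \oo] --> f l) ->
    (forall n l, `|f_ n l| <= g l) ->
  gint k (f_ n) @[n --> \oo] --> gint k f.
Proof.
move=> k0 tf_ tf tg f_f f_g; apply: fine_cvg; rewrite gint_EFin//.
have [||||_ _] := @dominated_convergence _ _ _ (lebesgue_tuple R N) setT measurableT
   (fun n l => (f_ n l * gaussian k l)%:E) (fun l => (f l * gaussian k l)%:E)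
   (fun l => (g l * gaussian k l)%:E) _ _ _ (integrable_tempered k0 tg) _.
- by move=> n; exact: measurable_int (integrable_tempered k0 (tf_ n)).
- exact: measurable_int (integrable_tempered k0 tf).
- apply: aeW => l _; apply: cvg_EFin; first exact: nearW.
  by apply: cvgMl; exact: f_f.
- apply: aeW => l n _; rewrite /= lee_fin normrM (gtr0_norm (gaussian_gt0 _ _)).
  by rewrite ler_wpM2r ?f_g// ltW// gaussian_gt0.
by [].
Qed.
End tempered_functions.

(** * Gradients and integration by parts *)

Section gradients.
Context (R : realType) (N : nat).
Local Notation mR := (measurableTypeR R).
Local Notation T := (N.-tuple mR).
Implicit Types (f g : T -> R) (l : T) (D E : 'I_N -> T -> R).

(** Continuity along coordinate lines, as the one-dimensional fundamental theorem of calculus asks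
    of a derivative. *)
Definition scont f := forall l i, continuous (fun x : R => f (upd l i x)).

Definition grad f D := forall i l (x : R),
  is_derive x 1 (fun y : R => f (upd l i y)) (D i (upd l i x)).

(* u is the logarithmic gradient of f, allowing zeros of f. *)
Definition lgrad f u := grad f (fun i l => u i l * f l).

Lemma grad_scont f D : grad f D -> scont f.
Proof.
by move=> fD l i x; apply/differentiable_continuous/derivable1_diffP; case: (fD i l x).
Qed.

Lemma scont_cst c : scont (fun=> c).
Proof. by move=> l i x; exact: cvg_cst. Qed.

Lemma scontD f g : scont f -> scont g -> scont (fun l => f l + g l).
Proof. by move=> cf cg l i x; apply: (@cvgD _ R^o); [exact: cf|exact: cg]. Qed.

Lemma scontM f g : scont f -> scont g -> scont (fun l => f l * g l).
Proof. by move=> cf cg l i x; apply: cvgM; [exact: cf|exact: cg]. Qed.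

Lemma scont_sum I (s : seq I) (P : pred I) (F : I -> T -> R) :
  (forall i, P i -> scont (F i)) -> scont (fun l => \sum_(i <- s | P i) F i l).
Proof.
move=> tF; elim: s => [|i s IH].
  by under eq_fun do rewrite big_nil; exact: scont_cst.
under eq_fun do rewrite big_cons.
by case: (boolP (P i)) => Pi; [exact: (scontD (tF i Pi) IH)|exact: IH].
Qed.

Lemma eq_grad f D E : (forall i l, D i l = E i l) -> grad f D -> grad f E.
Proof. by move=> DE fD i l x; rewrite -DE. Qed.

Lemma grad_cst c : grad (fun=> c) (fun _ _ => 0).
Proof. by move=> i l x; exact: is_derive_cst. Qed.

Lemma grad_tnth j : grad (fun l => tnth l j) (fun i _ => (j == i)%:R).
Proof.
move=> i l x; under eq_fun do rewrite tnth_upd.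
by case: eqP => _; [exact: is_derive_id|exact: is_derive_cst].
Qed.

Lemma gradD f g D E : grad f D -> grad g E ->
  grad (fun l => f l + g l) (fun i l => D i l + E i l).
Proof. by move=> fD gE i l x; apply: (is_deriveD (fD i l x) (gE i l x)). Qed.

Lemma gradB f g D E : grad f D -> grad g E ->
  grad (fun l => f l - g l) (fun i l => D i l - E i l).
Proof. by move=> fD gE i l x; apply: (is_deriveB (fD i l x) (gE i l x)). Qed.

Lemma gradM f g D E : grad f D -> grad g E ->
  grad (fun l => f l * g l) (fun i l => D i l * g l + f l * E i l).
Proof.
move=> fD gE i l x; apply: is_derive_eq (is_deriveM (fD i l x) (gE i l x)) _.
by rewrite addrC [X in X + _]mulrC.
Qed.

Lemma grad_comp (phi phi' : R -> R) f D :
    (forall y : R, is_derive y 1 phi (phi' y)) -> grad f D ->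
  grad (fun l => phi (f l)) (fun i l => phi' (f l) * D i l).
Proof. by move=> dphi fD i l x; exact: is_derive1_comp (dphi _) (fD i l x). Qed.

Lemma grad_sum I (s : seq I) (F : I -> T -> R) (DF : I -> 'I_N -> T -> R) :
  (forall a, grad (F a) (DF a)) ->
  grad (fun l => \sum_(a <- s) F a l) (fun i l => \sum_(a <- s) DF a i l).
Proof.
move=> FD; elim: s => [|a s IH] i l x.
  under eq_fun do rewrite big_nil.
  by rewrite big_nil; exact: is_derive_cst.
under eq_fun do rewrite big_cons.
by rewrite big_cons; exact: gradD (FD a) IH i l x.
Qed.

(** Logarithmic gradients add under multiplication; in the form u f this is the product rule and
    holds at zeros too. *)
Lemma lgrad_prod I (s : seq I) (P : pred I) (F : I -> T -> R) (u : I -> 'I_N -> T -> R) :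
  (forall a, P a -> lgrad (F a) (u a)) ->
  lgrad (fun l => \prod_(a <- s | P a) F a l) (fun i l => \sum_(a <- s | P a) u a i l).
Proof.
move=> Fu; elim: s => [|a s IH] i l x.
  under eq_fun do rewrite big_nil.
  by rewrite !big_nil mul0r; exact: is_derive_cst.
under eq_fun do rewrite big_cons.
rewrite !big_cons; case: (boolP (P a)) => Pa; last exact: IH.
apply: is_derive_eq (gradM (Fu a Pa) IH i l x) _.
by ring.
Qed.

Lemma lgrad_gaussian (k : R) : lgrad (@gaussian R N k) (fun i l => - (2 * k * tnth l i)).
Proof.
have dg (y : R) : is_derive y 1 (gauss k) (- (2 * k * y) * gauss k y).
  have e : is_derive y 1 (fun z : R => - k * z ^+ 2) (- (2 * k * y)).
    apply: is_derive_eq (is_deriveZ (- k) (is_deriveX 2 (is_derive_id y (1:R)))) _.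
    by rewrite /= /GRing.scale/= expr1; ring.
  by apply: is_derive_eq (is_derive1_comp (is_derive_expR _) e) _; rewrite mulrC.
have h j : lgrad (fun l => gauss k (tnth l j)) (fun i l => - (2 * k * tnth l j) * (j == i)%:R).
  by apply: eq_grad (grad_comp dg (grad_tnth j)) => i l; rewrite mulrAC.
apply: (eq_grad _ (@lgrad_prod _ (index_enum 'I_N) xpredT _ _ (fun j _ => h j))) => i l.
congr (_ * _).
rewrite (bigD1 i)//= eqxx mulr1 big1 ?addr0// => j /negbTE ->.
by rewrite mulr0.
Qed.

Lemma gaussian_upd_le (k : R) l i x : 0 < k -> gaussian k (upd l i x) <= gauss k x.
Proof.
move=> k0; rewrite /gaussian (bigD1 i)//= tnth_upd eqxx ler_piMr ?gauss_ge0//.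
apply: prodr_ile1 => j _; rewrite gauss_ge0 /gauss -expR0 ler_expR mulNr oppr_le0.
by rewrite mulr_ge0 ?sqr_ge0// ltW.
Qed.

(** Integration by parts: the integrand times the Gaussian is the i-th partial derivative of f times
    the Gaussian, so its integral along each i-th coordinate line vanishes. *)
Lemma gint_grad (k : R) f D i : 0 < k -> tempered f -> grad f D ->
  tempered (D i) -> scont (D i) ->
  gint k (fun l => D i l - 2 * k * tnth l i * f l) = 0.
Proof.
move=> k0 tf fD tD cD.
set H := fun l => _ : R.
have tH : tempered H.
  have tn : tempered (fun l : T => tnth l i) by exact: (@tempered_tnthX R N i 1).
  exact: (temperedD tD (temperedN (temperedM (temperedM (tempered_cst _ (2 * k)) tn) tf))).
have k20 : 0 < k / 2 by rewrite divr_gt0.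
have [C C0 leC] := tempered_gaussian_le k0 tf.
have [C' C'0 leC'] := tempered_gaussian_le k0 tH.
have cH : scont (fun l => H l * gaussian k l).
  rewrite /H; under eq_fun do rewrite -mulNr -mulNr.
  have cn := scontM (@scont_cst (- (2 * k))) (grad_scont (grad_tnth i)).
  exact: (scontM (scontD cD (scontM cn (grad_scont fD))) (grad_scont (lgrad_gaussian k))).
apply: EFin_inj; rewrite gint_EFin//.
apply: (@integral_upd0 _ _ _ i C' (gauss (k / 2))) => //.
- exact: measurable_gauss.
- exact: gauss_ge0.
- exact: integrable_gauss.
- by apply: measurable_funM; [case: tH|exact: measurable_gaussian].
move=> l; apply: (@integral_derive_gauss_bound _ (fun x => f (upd l i x) * gaussian k (upd l i x)) _ (k / 2) (C + C')) => //.
- move=> x; apply: is_derive_eq (gradM fD (lgrad_gaussian k) i l x) _.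
  by rewrite /H; ring.
- move=> x; apply: le_trans (leC _) _.
  by apply: ler_pM; rewrite ?gaussian_upd_le ?lerDl// ltW// gaussian_gt0.
- move=> x; apply: le_trans (leC' _) _.
  by apply: ler_pM; rewrite ?gaussian_upd_le ?lerDr// ltW// gaussian_gt0.
Qed.
End gradients.

(** * The regularised weight *)

Section regularised_weight.
Context (R : realType) (kappa : R) (kappa_gt0 : 0 < kappa) (N : nat).
Local Notation mR := (measurableTypeR R).
Local Notation T := (N.-tuple mR).
Implicit Types (F : T -> R) (l : T) (D : 'I_N -> T -> R) (e y : R).

Definition reg_pow e y : R := (y ^+ 2 + e) `^ kappa.

Definition reg_vdm e l : R :=
  \prod_(j < N) \prod_(k < N | (j < k)%N) reg_pow e (tnth l k - tnth l j).

Lemma measurable_reg_pow e : measurable_fun setT (reg_pow e).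
Proof.
apply: (measurableT_comp (measurable_powR _)).
by apply: measurable_funD => //; exact: measurable_funX.
Qed.

Lemma reg_pow_ge0 e y : 0 <= reg_pow e y.
Proof. exact: powR_ge0. Qed.

Lemma le_reg_pow e y : 0 <= e <= 1 -> reg_pow e y <= reg_pow 1 y.
Proof.
move=> /andP[e0 e1]; apply: ge0_ler_powR; rewrite ?nnegrE ?addr_ge0 ?sqr_ge0 ?lerD2l//.
exact: ltW.
Qed.

Lemma tempered_reg_vdm e : 0 <= e <= 1 -> tempered (reg_vdm e).
Proof.
move=> e01; apply: tempered_prod => j _; apply: tempered_prod => k _.
(* [Num.bound kappa] is a natural number above kappa, and 1 + y^2 >= 1, so the real power is below
   the integral one. *)
apply: (@tempered_sub_comp _ _ _ 1 (Num.bound kappa)) => //.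
  exact: measurable_reg_pow.
move=> y; rewrite ger0_norm ?reg_pow_ge0// mul1r (le_trans (le_reg_pow y e01))//.
rewrite /reg_pow addrC -(@powR_mulrn _ (1 + y ^+ 2)) ?addr_ge0 ?sqr_ge0// ler_powR ?lerDl ?sqr_ge0//.
by rewrite ltW// archi_boundP// ltW.
Qed.

Lemma gbe_weightE l : gbe_weight kappa l = reg_vdm 0 l * gaussian kappa l.
Proof.
rewrite /gbe_weight mulrC; congr (_ * _).
apply: eq_bigr => j _; apply: eq_bigr => k _.
by rewrite powRrM powR_mulrn// real_normK ?num_real// /reg_pow addr0.
Qed.

Lemma reg_vdm_ge0 e l : 0 <= reg_vdm e l.
Proof. by apply: prodr_ge0 => j _; apply: prodr_ge0 => k _; exact: reg_pow_ge0. Qed.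

(** The value at e = 1 dominates uniformly in e. *)
Lemma le_reg_vdm e l : 0 <= e <= 1 -> reg_vdm e l <= reg_vdm 1 l.
Proof.
move=> e01; apply: ler_prod => j _; apply/andP; split.
  by apply: prodr_ge0 => k _; exact: reg_pow_ge0.
by apply: ler_prod => k _; rewrite reg_pow_ge0 le_reg_pow.
Qed.

Lemma cvg_reg_vdm l : reg_vdm n.+1%:R^-1 l @[n --> \oo] --> reg_vdm 0 l.
Proof.
have h y : reg_pow n.+1%:R^-1 y @[n --> \oo] --> reg_pow 0 y.
  (* At y = 0 the claim is that e^kappa tends to 0, by kappa > 0; elsewhere the power is
     differentiable at y^2 > 0. *)
  rewrite /reg_pow addr0; have [->|y0] := eqVneq y 0.
    rewrite expr0n/= powR0 ?gt_eqF//; under eq_fun do rewrite add0r.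
    have /cvg_at_rightP/(_ (fun n => n.+1%:R^-1)) := powR_cvg0 kappa_gt0.
    apply; split=> [n|].
      by rewrite invr_gt0.
    exact: cvg_harmonic.
  have p0 : 0 < y ^+ 2 by rewrite exprn_even_gt0.
  have := ex_derive (is_derive := is_derive1_powR kappa p0).
  move=> /derivable1_diffP/differentiable_continuous c.
  apply: continuous_cvg c _.
  rewrite -[X in _ --> X]addr0; apply: (@cvgD _ R^o); first exact: cvg_cst.
  exact: cvg_harmonic.
apply: (cvg_big mul_continuous) => j _.
by apply: (cvg_big mul_continuous) => k _; exact: h.
Qed.

(** A regularised 1/y: half the logarithmic derivative of y^2 + e. *)
Definition reg_slope e y : R := y / (y ^+ 2 + e).

Lemma is_derive_reg_pow e y : 0 < e ->
  is_derive y 1 (reg_pow e) (2 * kappa * reg_slope e y * reg_pow e y).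
Proof.
move=> e0; have p0 : 0 < y ^+ 2 + e by rewrite ltr_wpDl// sqr_ge0.
have dq : is_derive y 1 (fun z : R => z ^+ 2 + e) (2 * y).
  apply: is_derive_eq (is_deriveD (is_deriveX 2 (is_derive_id y (1:R))) (is_derive_cst e y 1)) _.
  by rewrite /= /GRing.scale/= expr1; ring.
have dp := @is_derive1_comp _ (fun a : R => a `^ kappa) (fun z => z ^+ 2 + e) y _ _
  (is_derive1_powR kappa p0) dq.
apply: is_derive_eq dp _.
rewrite /reg_pow -(mulr_powRB1 (ltW p0) kappa_gt0) /reg_slope.
by field; rewrite gt_eqF.
Qed.

Definition reg_force e (i : 'I_N) l : R :=
  \sum_(j < N) \sum_(k < N | (j < k)%N)
    2 * kappa * reg_slope e (tnth l k - tnth l j) * ((k == i)%:R - (j == i)%:R).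

Lemma lgrad_reg_vdm e : 0 < e -> lgrad (reg_vdm e) (reg_force e).
Proof.
move=> e0; apply: (@lgrad_prod R N _ (index_enum 'I_N) xpredT) => j _.
apply: (@lgrad_prod R N _ (index_enum 'I_N) (fun k : 'I_N => (j < k)%N)) => k _.
have := grad_comp (fun y => is_derive_reg_pow y e0) (gradB (grad_tnth k) (grad_tnth j)).
by apply: eq_grad => i l; rewrite mulrAC.
Qed.

(** The constant 1/e is harmless at fixed e. Bounds uniform in e appear only after multiplication by
    l_k^r - l_j^r, in [ler_reg_slopeM]. *)
Lemma tempered_reg_slope e j k : 0 < e ->
  tempered (fun l : T => reg_slope e (tnth l k - tnth l j)).
Proof.
move=> e0; apply: (@tempered_sub_comp _ _ _ e^-1 1).
- apply: continuous_measurable_fun => y; apply: cvgM; first exact: cvg_id.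
  apply: cvgV; first by rewrite gt_eqF// ltr_wpDl// sqr_ge0.
  by apply: (@cvgD _ R^o); [exact: exprn_continuous|exact: cvg_cst].
- by rewrite invr_ge0 ltW.
move=> y; rewrite expr1 normrM mulrC ler_pM//.
  rewrite normfV gtr0_norm ?ltr_wpDl ?sqr_ge0// lef_pV2 ?posrE ?ltr_wpDl ?sqr_ge0//.
  by rewrite lerDr sqr_ge0.
by rewrite -(real_normK (num_real y)); have := sqr_ge0 (`|y| - 1); nra.
Qed.

Lemma scont_reg_slope e j k : 0 < e ->
  scont (fun l : T => reg_slope e (tnth l k - tnth l j)).
Proof.
move=> e0 l i x.
have cs : continuous (reg_slope e).
  move=> y; apply: cvgM; first exact: cvg_id.
  apply: cvgV; first by rewrite gt_eqF// ltr_wpDl// sqr_ge0.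
  by apply: (@cvgD _ R^o); [exact: exprn_continuous|exact: cvg_cst].
apply: (@continuous_comp _ _ _ (fun y : R => tnth (upd l i y) k - tnth (upd l i y) j)); last exact: cs.
exact: (grad_scont (gradB (grad_tnth k) (grad_tnth j))).
Qed.

Definition force_div e r l : R :=
  \sum_(j < N) \sum_(k < N | (j < k)%N)
    2 * kappa * reg_slope e (tnth l k - tnth l j) * (tnth l k ^+ r - tnth l j ^+ r).

(** The indicators of k = i and j = i collapse the sum over i, and the force on each pair acquires
    the factor l_k^r - l_j^r that cancels its singularity. *)
Lemma force_divE e r l :
  \sum_(i < N) tnth l i ^+ r * reg_force e i l = force_div e r l.
Proof.
under eq_bigr do rewrite mulr_sumr; rewrite exchange_big; apply: eq_bigr => j _.
under eq_bigr do rewrite mulr_sumr; rewrite exchange_big; apply: eq_bigr => k _.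
under eq_bigr do rewrite mulrCA mulrBr.
rewrite -mulr_sumr sumrB; congr (_ * (_ - _)).
  rewrite (bigD1 k)//= eqxx mulr1 big1 ?addr0// => i /negbTE.
  by rewrite eq_sym => ->; rewrite mulr0.
rewrite (bigD1 j)//= eqxx mulr1 big1 ?addr0// => i /negbTE.
by rewrite eq_sym => ->; rewrite mulr0.
Qed.

End regularised_weight.

(** * The loop equations *)

Section loop_equation.
Context (R : realType) (kappa : R) (kappa_gt0 : 0 < kappa) (N : nat).
Local Notation mR := (measurableTypeR R).
Local Notation T := (N.-tuple mR).
Local Notation p_ := (@power_sum R N).
Implicit Types (F : T -> R) (l : T) (D : 'I_N -> T -> R) (e y : R).

Lemma tempered_power_sum q : tempered (p_ q).
Proof. by apply: tempered_sum => j _; exact: tempered_tnthX. Qed.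

Lemma tempered_force e (i : 'I_N) : 0 < e -> tempered (reg_force kappa e i).
Proof.
move=> e0; apply: tempered_sum => j _; apply: tempered_sum => k _.
exact: temperedM (temperedM (tempered_cst _ _) (tempered_reg_slope _ _ e0)) (tempered_cst _ _).
Qed.

Lemma scont_force e (i : 'I_N) : 0 < e -> scont (reg_force kappa e i).
Proof.
move=> e0; apply: scont_sum => j _; apply: scont_sum => k _.
exact: scontM (scontM (@scont_cst _ _ _) (@scont_reg_slope _ _ _ j k e0)) (@scont_cst _ _ _).
Qed.

Lemma is_derive_exp r y : is_derive y 1 (fun z : R => z ^+ r) (r%:R * y ^+ r.-1).
Proof.
rewrite (_ : (fun z => _) = horner 'X^r); last by apply/funext => z; rewrite hornerXn.
by apply: is_derive_eq; rewrite derivXn hornerMn hornerXn mulr_natl.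
Qed.

Lemma scont_tnthX (j : 'I_N) r : scont (fun l => tnth l j ^+ r).
Proof. exact: grad_scont (grad_comp (is_derive_exp r) (grad_tnth j)). Qed.

(** Sum over i of [gint_grad] applied to l_i^r F times the regularised Vandermonde factor. *)
Lemma reg_loop_equation e r F D : 0 < e <= 1 ->
    tempered F -> grad F D -> (forall i, tempered (D i)) -> (forall i, scont (D i)) ->
  gint kappa (fun l => reg_vdm kappa e l *
    (r%:R * p_ r.-1 l * F l + \sum_(i < N) tnth l i ^+ r * D i l
     - 2 * kappa * p_ r.+1 l * F l + F l * force_div kappa e r l)) = 0.
Proof.
move=> /andP[e0 e1] tF FD tD cD.
have tV : tempered (@reg_vdm _ kappa N e) by apply: tempered_reg_vdm => //; rewrite (ltW e0).
have gV := @lgrad_reg_vdm _ _ kappa_gt0 N _ e0.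
have gE i := gradM (gradM (grad_comp (is_derive_exp r) (grad_tnth i)) FD) gV.
have tX i q : tempered (fun l : T => tnth l i ^+ q) by exact: tempered_tnthX.
have tfE i : tempered (fun l => tnth l i ^+ r * F l * reg_vdm kappa e l).
  exact: temperedM (temperedM (tX i r) tF) tV.
have tG i : tempered (fun l => (r%:R * tnth l i ^+ r.-1 * (i == i)%:R * F l
     + tnth l i ^+ r * D i l) * reg_vdm kappa e l
     + tnth l i ^+ r * F l * (reg_force kappa e i l * reg_vdm kappa e l)).
  apply: temperedD; first apply: temperedM (tV).
    apply: temperedD (temperedM (tX i r) (tD i)).
    exact: temperedM (temperedM (temperedM (tempered_cst _ _) (tX i _)) (tempered_cst _ _)) tF.
  exact: temperedM (temperedM (tX i r) tF) (temperedM (tempered_force i e0) tV).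
have cG i : scont (fun l => (r%:R * tnth l i ^+ r.-1 * (i == i)%:R * F l
     + tnth l i ^+ r * D i l) * reg_vdm kappa e l
     + tnth l i ^+ r * F l * (reg_force kappa e i l * reg_vdm kappa e l)).
  have cF := grad_scont FD; have cV := grad_scont gV.
  have c1 := scontM (scontM (@scont_cst _ N r%:R) (@scont_tnthX i r.-1)) (@scont_cst _ N (i == i)%:R).
  have c2 := scontD (scontM c1 cF) (scontM (@scont_tnthX i r) (cD i)).
  exact: scontD (scontM c2 cV) (scontM (scontM (@scont_tnthX i r) cF) (scontM (@scont_force e i e0) cV)).
have I0 i := gint_grad kappa_gt0 (tfE i) (gE i) (tG i) (cG i).
transitivity (\sum_(i < N) (0 : R)); last by rewrite big1.
under [RHS]eq_bigr => i _ do rewrite -(I0 i).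
rewrite -gint_sum//; last first.
  move=> i; apply: temperedD => //; apply: temperedN.
  exact: temperedM (temperedM (tempered_cst _ _) (tX i 1%N)) (tfE i).
apply: eq_Rintegral => l _; congr (_ * _).
rewrite -force_divE /power_sum !mulr_sumr.
rewrite !mulr_suml -sumrN -!big_split mulr_sumr; apply: eq_bigr => i _ /=.
by rewrite eqxx mulr1 exprS; ring.
Qed.

(** * Removal of the regularisation *)

Definition diff_quot r (x y : R) : R := \sum_(a < r) x ^+ (r.-1 - a) * y ^+ a.

(** The limit of [force_div] as e tends to 0 at points with distinct coordinates, extended to
    collisions as a polynomial. *)
Definition force_lim r l : R :=
  \sum_(j < N) \sum_(k < N | (j < k)%N) 2 * kappa * diff_quot r (tnth l k) (tnth l j).

Lemma reg_slopeM e r (x y : R) : reg_slope e (x - y) * (x ^+ r - y ^+ r) =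
  (x - y) ^+ 2 / ((x - y) ^+ 2 + e) * diff_quot r x y.
Proof. by rewrite subrXX /reg_slope/diff_quot; ring. Qed.

(** The factor (x - y)^2 / ((x - y)^2 + e) lies in [0, 1], so the bound is independent of e. *)
Lemma ler_reg_slopeM e r (x y : R) : 0 < e ->
  `|reg_slope e (x - y) * (x ^+ r - y ^+ r)| <= `|diff_quot r x y|.
Proof.
move=> e0; rewrite reg_slopeM normrM ler_piMl//.
rewrite ger0_norm ?divr_ge0 ?addr_ge0 ?sqr_ge0 ?(ltW e0)//.
by rewrite ler_pdivrMr ?ltr_wpDl ?sqr_ge0// mul1r lerDl ltW.
Qed.

(* Where l_k = l_j the terms vanish identically, and so does the limit weight. *)
Lemma cvg_reg_force (j k : 'I_N) r l : (j < k)%N ->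
  reg_vdm kappa n.+1%:R^-1 l * (2 * kappa * reg_slope n.+1%:R^-1 (tnth l k - tnth l j) *
     (tnth l k ^+ r - tnth l j ^+ r)) @[n --> \oo] -->
  reg_vdm kappa 0 l * (2 * kappa * diff_quot r (tnth l k) (tnth l j)).
Proof.
move=> jk; have [e|ne] := eqVneq (tnth l k) (tnth l j).
  have -> : reg_vdm kappa 0 l = 0.
    rewrite /reg_vdm (bigD1 j)//= (bigD1 k)//= e /reg_pow subrr expr0n addr0.
    by rewrite powR0 ?gt_eqF// !mul0r.
  under eq_fun do rewrite e !subrr !mulr0.
  by rewrite mul0r; exact: cvg_cst.
apply: cvgM; first exact: cvg_reg_vdm.
under eq_fun do rewrite -mulrA reg_slopeM.
have y0 : (tnth l k - tnth l j) ^+ 2 != 0 by rewrite sqrf_eq0 subr_eq0.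
have -> : 2 * kappa * diff_quot r (tnth l k) (tnth l j) = 2 * kappa *
    ((tnth l k - tnth l j) ^+ 2 / (tnth l k - tnth l j) ^+ 2 * diff_quot r (tnth l k) (tnth l j)).
  by rewrite divff// mul1r.
apply: cvgM; first exact: cvg_cst.
apply: cvgM; last exact: cvg_cst.
apply: cvgM; first exact: cvg_cst.
apply: cvgV => //.
rewrite -[X in _ --> X]addr0; apply: (@cvgD _ R^o); first exact: cvg_cst.
exact: cvg_harmonic.
Qed.

Lemma tempered_diff_quot r (j k : 'I_N) :
  tempered (fun l => diff_quot r (tnth l k) (tnth l j)).
Proof. by apply: tempered_sum => a _; apply: temperedM; exact: tempered_tnthX. Qed.

Lemma loop_equation_force r F D :
    tempered F -> grad F D -> (forall i, tempered (D i)) -> (forall i, scont (D i)) ->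
  gint kappa (fun l => reg_vdm kappa 0 l *
    (r%:R * p_ r.-1 l * F l + \sum_(i < N) tnth l i ^+ r * D i l
     - 2 * kappa * p_ r.+1 l * F l + F l * force_lim r l)) = 0.
Proof.
move=> tF FD tD cD.
pose A l := r%:R * p_ r.-1 l * F l + \sum_(i < N) tnth l i ^+ r * D i l
     - 2 * kappa * p_ r.+1 l * F l.
have tp q : tempered (p_ q) by exact: tempered_power_sum.
have tA : tempered A.
  have t1 := temperedM (temperedM (tempered_cst N r%:R) (tp r.-1)) tF.
  have t2 : tempered (fun l => \sum_(i < N) tnth l i ^+ r * D i l).
    by apply: tempered_sum => i _; exact: temperedM (tempered_tnthX _ i r) (tD i).
  have t3 := temperedM (temperedM (tempered_cst N (2 * kappa)) (tp r.+1)) tF.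
  exact: temperedD (temperedD t1 t2) (temperedN t3).
have tV e : 0 <= e <= 1 -> tempered (@reg_vdm _ kappa N e) by exact: tempered_reg_vdm.
have n01 n : 0 < (n.+1%:R^-1 : R) <= 1 by rewrite invr_gt0 ltr0Sn invf_le1// ler1n.
have n01' n : 0 <= (n.+1%:R^-1 : R) <= 1 by case/andP: (n01 n) => /ltW -> ->.
have tFD e : 0 < e -> tempered (force_div kappa e r).
  move=> e0; apply: tempered_sum => j _; apply: tempered_sum => k _.
  apply: temperedM (temperedM (tempered_cst _ _) (tempered_reg_slope _ _ e0)) _.
  by apply: temperedD (tempered_tnthX _ _ _) (temperedN (tempered_tnthX _ _ _)).
(* A bound for [force_div] valid for every e > 0; the dominating function is [reg_vdm kappa 1] times
   |A| + |F| B. *)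
pose B l := \sum_(j < N) \sum_(k < N | (j < k)%N) 2 * kappa * `|diff_quot r (tnth l k) (tnth l j)|.
have tB : tempered B.
  apply: tempered_sum => j _; apply: tempered_sum => k _.
  exact: temperedM (tempered_cst _ _) (tempered_norm (tempered_diff_quot _ _ _)).
have tL : tempered (force_lim r).
  apply: tempered_sum => j _; apply: tempered_sum => k _.
  exact: temperedM (tempered_cst _ _) (tempered_diff_quot _ _ _).
have : gint kappa (fun l => reg_vdm kappa n.+1%:R^-1 l * (A l + F l * force_div kappa n.+1%:R^-1 r l))
    @[n --> \oo] --> gint kappa (fun l => reg_vdm kappa 0 l * (A l + F l * force_lim r l)).
  apply: (@gint_cvg _ _ _ _ _ (fun l => reg_vdm kappa 1 l * (`|A l| + `|F l| * B l)) kappa_gt0).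
  - move=> n; apply: temperedM; first exact: tV.
    by apply: temperedD => //; apply: temperedM => //; apply: tFD; case/andP: (n01 n).
  - apply: temperedM; first by apply: tV; rewrite lexx ler01.
    by apply: temperedD => //; apply: temperedM.
  - apply: temperedM; first by apply: tV; rewrite lexx ler01.
    by apply: temperedD; [exact: tempered_norm|apply: temperedM => //; exact: tempered_norm].
  - move=> l; rewrite mulrDr; under eq_fun do rewrite mulrDr.
    apply: (@cvgD _ R^o); first by apply: cvgMl; exact: cvg_reg_vdm.
    rewrite mulrCA; under eq_fun do rewrite mulrCA.
    apply: cvgMr; rewrite /force_lim/force_div mulr_sumr; under eq_fun do rewrite mulr_sumr.
    apply: (cvg_big add_continuous) => j _.
    rewrite mulr_sumr; under eq_fun do rewrite mulr_sumr.
    by apply: (cvg_big add_continuous) => k jk; exact: cvg_reg_force.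
  - move=> n l; rewrite normrM (ger0_norm (reg_vdm_ge0 _ _ _)).
    apply: ler_pM => //; first exact: reg_vdm_ge0.
      exact: le_reg_vdm.
    apply: le_trans (ler_normD _ _) _; rewrite lerD2l normrM ler_wpM2l//.
    apply: le_trans (ler_norm_sum _ _ _) _; apply: ler_sum => j _.
    apply: le_trans (ler_norm_sum _ _ _) _; apply: ler_sum => k _.
    rewrite -mulrA normrM gtr0_norm ?mulr_gt0// ler_pM2l ?mulr_gt0//.
    by apply: ler_reg_slopeM; case/andP: (n01 n).
under eq_fun => n do rewrite (reg_loop_equation r (n01 n) tF FD tD cD).
by move/cvg_lim => /= <-//; rewrite lim_cst.
Qed.

(** The difference quotient is symmetric in j and k, so twice the sum over j < k is the full double
    sum, which factors into power sums, minus the diagonal r p_(r-1). That diagonal accounts for the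
    1 - kappa in the loop equations. *)
Lemma force_limE r l :
  force_lim r l = kappa * (\sum_(a < r) p_ a l * p_ (r.-1 - a)%N l - r%:R * p_ r.-1 l).
Proof.
pose S (j k : 'I_N) := diff_quot r (tnth l k) (tnth l j).
have Ssym j k : S j k = S k j.
  rewrite /S /diff_quot (reindex_inj rev_ord_inj); apply: eq_bigr => a _ /=.
  rewrite mulrC; congr (_ ^+ _ * _ ^+ _); have := ltn_ord a; lia.
have diagE : \sum_j S j j = r%:R * p_ r.-1 l.
  rewrite mulr_sumr; apply: eq_bigr => j _; rewrite /S/diff_quot.
  rewrite (eq_bigr (fun=> tnth l j ^+ r.-1)).
    by rewrite sumr_const card_ord mulr_natl.
  by move=> a _; rewrite -exprD; congr (_ ^+ _); have := ltn_ord a; lia.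
have allE : \sum_j \sum_k S j k = \sum_(a < r) p_ a l * p_ (r.-1 - a)%N l.
  rewrite /S /diff_quot; under eq_bigr do rewrite exchange_big.
  rewrite exchange_big; apply: eq_bigr => a _.
  rewrite mulr_suml; apply: eq_bigr => j _.
  by rewrite mulr_sumr; apply: eq_bigr => k _; rewrite mulrC.
rewrite -allE -diagE.
have -> : \sum_j \sum_k S j k = \sum_j S j j +
    2 * \sum_(j < N) \sum_(k < N | (j < k)%N) S j k.
  transitivity (\sum_j (S j j + \sum_(k < N | (j < k)%N) S j k + \sum_(k < N | (k < j)%N) S j k)).
    apply: eq_bigr => j _; rewrite (bigD1 j)//= -addrA; congr (_ + _).
    rewrite (bigID (fun k : 'I_N => (j < k)%N))/=; congr (_ + _);
      apply: eq_bigl => k; rewrite -val_eqE/=; lia.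
  rewrite !big_split/= -addrA; congr (_ + _).
  rewrite mulrDl mul1r; congr (_ + _).
  rewrite (exchange_big_dep xpredT)//=; apply: eq_bigr => j _.
  by apply: eq_bigr => k _; rewrite Ssym.
rewrite addrC addKr mulrA [kappa * 2]mulrC mulr_sumr; apply: eq_bigr => j _.
by rewrite mulr_sumr.
Qed.

End loop_equation.

(** * Moments of the ensemble *)

Section gbe_moments.
Context (R : realType) (kappa : R) (kappa_gt0 : 0 < kappa) (N : nat).
Local Notation mR := (measurableTypeR R).
Local Notation T := (N.-tuple mR).
Local Notation p_ := (@power_sum R N).
Local Notation E := (@gbe_mean R N kappa).
Local Notation vdm := (@reg_vdm R kappa N 0).
Implicit Types (f g : T -> R) (l : T).

Let tempered_vdm : tempered vdm.
Proof. by apply: tempered_reg_vdm; rewrite // lexx ler01. Qed.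

Let tempered_vdmM f : tempered f -> tempered (fun l => vdm l * f l).
Proof. exact: temperedM. Qed.

(** Needed for the mean of 1 to be 1, the initial value of the recursion. *)
Lemma gbe_weight_integral_gt0 : 0 < gint kappa vdm.
Proof.
rewrite -lte_fin gint_EFin//.
(* On the box of the l_j in [2j, 2j+1] all differences are at least 1. *)
pose h (j : 'I_N) x := gauss kappa (2 * j%:R + 1) * \1_(`[2 * j%:R, 2 * j%:R + 1]%classic : set R) x.
have mh j : measurable_fun setT (h j).
  by apply: measurable_funM => //; apply: measurable_indic; exact: measurable_itv.
have h0 j x : 0 <= h j x by rewrite mulr_ge0 ?gauss_ge0.
apply: (@lt_le_trans _ _ (\int[lebesgue_tuple R N]_l (\prod_(j < N) h j (tnth l j))%:E)%E).
  rewrite ge0_integral_prod_tuple//.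
  have ih j : (\int[lebesgue_measure]_x (h j x)%:E = (gauss kappa (2 * j%:R + 1))%:E)%E.
    under eq_integral do rewrite EFinM.
    have mI : measurable_fun [set: R] (\1_(`[2 * j%:R, 2 * j%:R + 1]%classic : set R) : R -> R).
      by apply: measurable_indic; exact: measurable_itv.
    rewrite ge0_integralZl//; last 2 first.
    - exact: (measurableT_comp (@EFin_measurable _ _) mI).
    - by rewrite lee_fin gauss_ge0.
    rewrite integral_indic//= ?setIT.
    rewrite lebesgue_measure_itv/= lte_fin ltrDl ltr01.
    by rewrite -EFinD addrAC subrr add0r mule1.
  by under eq_bigr do rewrite ih; rewrite prodEFin lte_fin prodr_gt0// => j _; exact: expR_gt0.
apply: ge0_le_integral => //.
- by move=> l _; rewrite lee_fin prodr_ge0.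
- by apply/measurable_EFinP; exact: measurable_prod_tnth.
- by apply/measurable_EFinP; apply: measurable_funM; [case: tempered_vdm|exact: measurable_gaussian].
move=> l _; rewrite lee_fin.
have [lbox|] := boolP [forall j : 'I_N, tnth l j \in `[2 * j%:R, 2 * j%:R + 1]]; last first.
  rewrite negb_forall => /existsP[j lj].
  rewrite (bigD1 j)//= {1}/h indicE memNset ?mulr0 ?mul0r.
    by rewrite mulr_ge0 ?reg_vdm_ge0// ltW// gaussian_gt0.
  by apply/negP.
move/forallP : lbox => lbox; rewrite -[leLHS]mul1r; apply: ler_pM => //.
- exact: prodr_ge0.
- rewrite /reg_vdm; elim/big_ind : _ => [//|x y|j _]; first exact: mulr_ege1.
  elim/big_ind : _ => [//|x y|k jk]; first exact: mulr_ege1.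
  rewrite /reg_pow addr0; apply: (@le_trans _ _ (1 `^ kappa)); first by rewrite powR1.
  rewrite ge0_ler_powR ?nnegrE ?sqr_ge0//; first exact: ltW.
  have := lbox j; have := lbox k; rewrite !in_itv/= => /andP[a _] /andP[_ b].
  have jk' : j%:R + 1 <= k%:R :> R by rewrite natr1 ler_nat.
  nra.
(* On [2j, 2j+1] the Gaussian is smallest at the right end. *)
apply: ler_prod => j _; rewrite h0/= /h -[leRHS]mulr1 ler_pM ?gauss_ge0//.
rewrite ler_expR !mulNr lerN2 ler_pM2l//.
have := lbox j; rewrite !in_itv/= => /andP[a b].
have j0 : 0 <= j%:R :> R by [].
by nra.
Qed.

Lemma gbe_meanE f : E f = gint kappa (fun l => vdm l * f l) / gint kappa vdm.
Proof.
rewrite /gbe_mean; congr (_ / _); apply: eq_Rintegral => l _.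
  by rewrite gbe_weightE; ring.
by rewrite gbe_weightE.
Qed.

Lemma gbe_meanD f g : tempered f -> tempered g ->
  E (fun l => f l + g l) = E f + E g.
Proof.
move=> tf tg; rewrite !gbe_meanE -mulrDl -gintD//; try exact: tempered_vdmM.
by congr (_ / _); apply: eq_Rintegral => l _; rewrite mulrDr.
Qed.

Lemma gbe_meanZ c f : tempered f -> E (fun l => c * f l) = c * E f.
Proof.
move=> tf; rewrite !gbe_meanE mulrA -gintZ//; last exact: tempered_vdmM.
by congr (_ / _); apply: eq_Rintegral => l _; rewrite mulrCA.
Qed.

Lemma gbe_mean_sum I (s : seq I) (F : I -> T -> R) : (forall i, tempered (F i)) ->
  E (fun l => \sum_(i <- s) F i l) = \sum_(i <- s) E (F i).
Proof.
move=> tF; under [RHS]eq_bigr do rewrite gbe_meanE.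
rewrite gbe_meanE -mulr_suml -gint_sum//; last by move=> i; exact: tempered_vdmM.
by congr (_ / _); apply: eq_Rintegral => l _; rewrite mulr_sumr.
Qed.

(** * Mixed moments of power sums *)

Definition psum_prod (q : seq nat) l : R := \prod_(a <- q) p_ a l.

Lemma tempered_psum_prod q : tempered (psum_prod q).
Proof. by apply: tempered_prod => a _; exact: tempered_power_sum. Qed.

Definition psum_grad (q : seq nat) (i : 'I_N) l : R :=
  \sum_(j < size q) (nth 0%N q j)%:R * tnth l i ^+ (nth 0%N q j).-1 * psum_prod (del j q) l.

Lemma grad_power_sum a : grad (p_ a) (fun i l => a%:R * tnth l i ^+ a.-1).
Proof.
have := @grad_sum R N _ (index_enum 'I_N) _ _ (fun j => grad_comp (is_derive_exp a) (grad_tnth j)).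
apply: eq_grad => i l; rewrite (bigD1 i)//= eqxx mulr1 big1 ?addr0// => j /negbTE ->.
by rewrite mulr0.
Qed.

Lemma psum_grad_cons a q i l : psum_grad (a :: q) i l =
  a%:R * tnth l i ^+ a.-1 * psum_prod q l + p_ a l * psum_grad q i l.
Proof.
rewrite /psum_grad big_ord_recl /= /del /= ?take0 ?drop0; congr (_ + _).
rewrite mulr_sumr; apply: eq_bigr => j _ /=.
by rewrite /psum_prod /del/= big_cons; ring.
Qed.

Lemma grad_psum_prod q : grad (psum_prod q) (psum_grad q).
Proof.
elim: q => [|a q IH].
  apply: (@eq_grad _ _ _ (fun _ _ => 0)); first by move=> i l; rewrite /psum_grad big_ord0.
  rewrite /psum_prod => i l x; under eq_fun do rewrite big_nil.
  exact: (@grad_cst _ _ 1 i l x).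
have -> : psum_prod (a :: q) = fun l => p_ a l * psum_prod q l.
  by apply/funext => l; rewrite /psum_prod big_cons.
by apply: eq_grad (gradM (grad_power_sum a) IH) => i l; rewrite psum_grad_cons.
Qed.

Lemma tempered_psum_grad q i : tempered (psum_grad q i).
Proof.
apply: tempered_sum => j _.
exact: temperedM (temperedM (tempered_cst _ _) (tempered_tnthX _ _ _)) (tempered_psum_prod _).
Qed.

Lemma scont_psum_grad q i : scont (psum_grad q i).
Proof.
apply: scont_sum => j _.
exact: scontM (scontM (@scont_cst _ _ _) (@scont_tnthX _ _ i _)) (grad_scont (grad_psum_prod _)).
Qed.

Lemma euler_psum_grad r q l : \sum_(i < N) tnth l i ^+ r * psum_grad q i l =
  \sum_(j < size q) (nth 0%N q j)%:R * psum_prod ((r + nth 0%N q j).-1 :: del j q) l.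
Proof.
under eq_bigr do rewrite mulr_sumr; rewrite exchange_big; apply: eq_bigr => j _.
rewrite /psum_prod big_cons; case: (nth 0%N q j) => [|a].
  by rewrite mul0r big1// => i _; rewrite !mul0r mulr0.
rewrite mulr_suml mulr_sumr; apply: eq_bigr => i _.
by rewrite addnS/= exprD; ring.
Qed.

(** By linearity the difference of the two sides is a single mean, whose numerator is
    [loop_equation_force] for F = [psum_prod q], with [force_limE] and [euler_psum_grad]
    substituted. *)
Lemma gbe_mean_loop r q :
  E (psum_prod (r.+1 :: q)) = (2 * kappa)^-1 *
    ((1 - kappa) * r%:R * E (psum_prod (r.-1 :: q))
     + kappa * (\sum_(a < r) E (psum_prod [:: (a : nat), (r.-1 - a)%N & q]))
     + \sum_(j < size q) (nth 0%N q j)%:R * E (psum_prod ((r + nth 0%N q j).-1 :: del j q))).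
Proof.
apply: (canRL (mulKf _)); first by rewrite mulf_neq0// gt_eqF.
have tp := tempered_psum_prod.
rewrite -!gbe_meanZ// -gbe_mean_sum// -gbe_meanZ; last exact: tempered_sum.
under [X in _ + X]eq_bigr do rewrite -gbe_meanZ//.
have tn j : tempered (fun l => (nth 0%N q j)%:R * psum_prod ((r + nth 0%N q j).-1 :: del j q) l).
  exact: temperedM (tempered_cst _ _) (tp _).
have ts : tempered (fun l => \sum_(a < r) psum_prod [:: (a : nat), (r.-1 - a)%N & q] l).
  exact: tempered_sum.
have t1 := temperedM (tempered_cst N ((1 - kappa) * r%:R)) (tp (r.-1 :: q)).
have t2 := temperedM (tempered_cst N kappa) ts.
have t3 : tempered (fun l => \sum_(j < size q) (nth 0%N q j)%:R * psum_prod ((r + nth 0%N q j).-1 :: del j q) l).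
  exact: tempered_sum.
rewrite -(@gbe_mean_sum _ (index_enum 'I_(size q)) (fun j l => (nth 0%N q j)%:R * psum_prod ((r + nth 0%N q j).-1 :: del j q) l))//.
rewrite -gbe_meanD// -gbe_meanD//; last exact: temperedD.
apply/eqP; rewrite eq_sym -subr_eq0 -(mulN1r (E _)) -gbe_meanZ; last first.
  exact: temperedM (tempered_cst _ _) (tp _).
rewrite -gbe_meanD; last 2 first.
- exact: temperedD (temperedD t1 t2) t3.
- exact: temperedM (tempered_cst _ _) (temperedM (tempered_cst _ _) (tp _)).
rewrite gbe_meanE mulf_eq0; apply/orP; left; apply/eqP.
rewrite -[RHS](loop_equation_force kappa_gt0 r (tp q) (grad_psum_prod q)
  (tempered_psum_grad q) (@scont_psum_grad q)).
have psumE a q' l : psum_prod (a :: q') l = p_ a l * psum_prod q' l.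
  by rewrite /psum_prod big_cons.
apply: eq_Rintegral => l _; rewrite euler_psum_grad force_limE//.
under [\sum_(a < r) psum_prod _ _]eq_bigr do rewrite !psumE mulrA.
by rewrite -mulr_suml [psum_prod (r.-1 :: q) l]psumE [psum_prod (r.+1 :: q) l]psumE; ring.
Qed.

Lemma gbe_mean_psum_prod0 : E (psum_prod [::]) = 1.
Proof.
rewrite gbe_meanE -[RHS](@divff _ (gint kappa vdm)) ?gt_eqF ?gbe_weight_integral_gt0//.
by congr (_ / _); apply: eq_Rintegral => l _; rewrite /psum_prod big_nil mulr1.
Qed.

(** The quantity [sumn q + size q] drops in every recursive call with nonzero coefficient, so the
    fuel never runs out. *)
Lemma gbe_mean_psum_prod m q : (sumn q + size q <= m)%N ->
  E (psum_prod q) = loop_mom (2 * kappa)^-1 kappa N%:R m q.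
Proof.
elim: m q => [|m IH] [|[|r] q]//= le_m.
- exact: gbe_mean_psum_prod0.
- by move: le_m; rewrite addnS.
- exact: gbe_mean_psum_prod0.
- rewrite -IH; last by lia.
  rewrite -gbe_meanZ; last exact: tempered_psum_prod.
  congr E; apply/funext => l; rewrite /psum_prod big_cons; congr (_ * _).
  by rewrite /power_sum; under eq_bigr do rewrite expr0; rewrite sumr_const card_ord.
rewrite gbe_mean_loop; congr (_ * (_ + _ + _)).
- case: r le_m => [|r] le_m; first by rewrite !mulr0 !mul0r.
  by rewrite IH//=; lia.
- congr (_ * _); apply: eq_bigr => a _; rewrite IH//=.
  have := ltn_ord a; lia.
apply: eq_bigr => j _; have := sumn_del (ltn_ord j); have := size_del (ltn_ord j).
case: (nth 0%N q j) => [|a] sz sm; first by rewrite !mul0r.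
by rewrite IH//=; lia.
Qed.
End gbe_moments.

(** * Polynomiality in N and duality *)

Section cumulant_polynomial.
Context (R : realType) (kappa : R) (kappa_gt0 : 0 < kappa).

Lemma muGE (N n : nat) (p : 'I_n -> nat) :
  muG N kappa p = loop_cumulant (2 * kappa)^-1 kappa N%:R p.
Proof.
apply: eq_bigr => pi _; congr (_ * _); apply: eq_bigr => B _ /=.
rewrite -gbe_mean_psum_prod//; congr gbe_mean; apply/funext => l.
by rewrite /psum_prod big_map big_enum.
Qed.

Definition loop_cumulant_poly n (p : 'I_n -> nat) : {poly R} :=
  loop_cumulant ((2 * kappa)^-1)%:P kappa%:P 'X p.

(** Evaluation at N is a ring morphism, hence commutes with the recursion. *)
Lemma extends_muG_loop n (p : 'I_n -> nat) :
  extends_muG kappa p (loop_cumulant_poly p).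
Proof.
move=> N _; rewrite muGE -horner_evalE rmorph_loop_cumulant /=.
by rewrite !horner_evalE !hornerC hornerX.
Qed.

Lemma poly_eq_nat (P Q : {poly R}) :
  (forall N : nat, (0 < N)%N -> P.[N%:R] = Q.[N%:R]) -> P = Q.
Proof.
move=> PQ; apply/eqP; rewrite -subr_eq0; apply/eqP.
pose rs : seq R := [seq i.+1%:R | i <- iota 0 (size (P - Q))].
apply: (@roots_geq_poly_eq0 _ _ rs).
- apply/allP => _ /mapP[i _ ->].
  by rewrite rootE hornerD hornerN PQ// subrr.
- by rewrite map_inj_uniq ?iota_uniq// => i j /eqP; rewrite eqr_nat => /eqP[].
- by rewrite size_map size_iota.
Qed.

(** An extension exists, so the chosen polynomial is one, and two extensions agree at all positive
    integers. *)
Lemma muG_polyE n (p : 'I_n -> nat) : muG_poly kappa p = loop_cumulant_poly p.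
Proof.
apply: poly_eq_nat => N N0; rewrite [RHS]extends_muG_loop//.
by have /(_ N N0) := xgetPex 0 (ex_intro _ _ (@extends_muG_loop n p)).
Qed.

Lemma muG_extE (N : complex R) n (p : 'I_n -> nat) :
  muG_ext N kappa p = loop_cumulant (2 * kappa%:C%C)^-1 kappa%:C%C N p.
Proof.
rewrite /muG_ext muG_polyE -horner_evalE !rmorph_loop_cumulant /= !horner_evalE.
by rewrite !map_polyC map_polyX !hornerC hornerX /= fmorphV rmorphM rmorph_nat.
Qed.

End cumulant_polynomial.

Theorem proposition1p1 (R : realType) (kappa : R) (kappa_gt0 : 0 < kappa)
    (n : nat) (n_gt0 : (0 < n)%N) :
  (forall p : 'I_n -> nat, exists P : {poly R}, extends_muG kappa p P) /\
  (forall N : complex R,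
    WG n N kappa =1
      series_scale ((- 'i / (Num.sqrt kappa)%:C%C) ^+ n)
        (series_dilate ('i * (Num.sqrt kappa)%:C%C)
          (WG n (- (kappa%:C%C * N)) kappa^-1))).
Proof.
split=> [p|N e].
  by exists (loop_cumulant_poly kappa p); exact: extends_muG_loop.
rewrite /series_scale /series_dilate /WG; case: ifPn => [/forallP e0|_]; last first.
  by rewrite !mulr0.
rewrite !muG_extE ?invr_gt0// fmorphV /=.
(* The dilation by i sqrt kappa multiplies the coefficient at e by the product of the s^(e i). *)
set k := kappa%:C%C; set t := (Num.sqrt kappa)%:C%C; pose s := ('i * t)^-1.
have k0 : k != 0 by rewrite fmorph_eq0 gt_eqF.
have t2 : t ^+ 2 = k by rewrite -rmorphXn/= sqr_sqrtr// ltW.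
have s2 : s ^+ 2 = - k^-1.
  by rewrite exprVn exprMn sqrCi t2 mulN1r invrN.
rewrite -(loop_cumulant_dual N _ k0 s2) ?pnatr_eq0// mulrA; congr (_ * _).
have -> : (- 'i / t) ^+ n = \prod_(i < n) (- 'i / t) by rewrite prodr_const card_ord.
rewrite -big_split; apply: eq_bigr => i _ /=.
(* A series exponent exceeds its moment exponent by one. The extra s meets the prefactor - i / sqrt
   kappa, which is again s, and s^2 = - k^-1 is the weight in [loop_cumulant_dual]. *)
rewrite -exprVn -/s -[in RHS](prednK (e0 i)) exprS mulrA; congr (_ * _).
rewrite -s2 expr2; congr (_ * _).
by rewrite /s invfM invCi.
Qed.
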